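(* Let $\tau,\rho\in\mathbb{R}$. The matrix $B(\tau,\rho)$, considered as a (potentially unbounded) linear operator on $\ell^2(\mathbb{N})$, has the following properties. (1) If $\tau>0$, then $B(\tau,\rho)$ is positive semi-definite. Moreover, for $\tau>0$: (a) if $\rho>1$, then $B(\tau,\rho)$ is bounded, compact and trace class; (b) if $\rho=1$, then $B(\tau,\rho)$ is bounded, but non-compact; (c) if $\rho<1$, then $B(\tau,\rho)$ is unbounded. (2) If $\tau=0$, then $B(\tau,\rho)$ is formally rank one, and it is bounded if and only if $\rho>1$. (3) If $\tau<0$, then $B(\tau,\rho)$ is bounded if and only if $\rho+\tau>1$; in this case it is also compact and trace class.
   Context: Here $\mathbb{N}=\{1,2,3,\dots\}$. For real $\tau,\rho$, $B(\tau,\rho)$ is the semi-infinite matrix indexed by $n,m\in\mathbb{N}$ with entries $$[B(\tau,\rho)]_{n,m}=\frac{(nm)^{\tau/2}}{(n\vee m)^{\tau}}\,\frac{1}{(nm)^{\rho/2}},$$ where $n\vee m=\max\{n,m\}$. ''Bounded'' means that the matrix is the matrix, in the standard basis, of a bounded linear operator on $\ell^2(\mathbb{N})$; ''unbounded'' means that it is not. ''Positive semi-definite'' means that $\sum_{n,m}[B(\tau,\rho)]_{n,m}f_n\overline{f_m}\ge 0$ for all finitely supported complex sequences $(f_n)_{n\in\mathbb{N}}$. ''Formally rank one'' means that the entries have the form $u_nu_m$ for some non-zero sequence $(u_n)_{n\in\mathbb{N}}$, not necessarily in $\ell^2(\mathbb{N})$. *)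

(* Defs.v *)
From HB Require Import structures.
From mathcomp Require Import all_boot all_order all_algebra.
From mathcomp Require Import complex.
From mathcomp Require Import all_classical all_reals all_analysis.

Set Implicit Arguments.
Unset Strict Implicit.
Unset Printing Implicit Defensive.
Import Order.TTheory GRing.Theory Num.Theory.
Import numFieldNormedType.Exports.
Local Open Scope classical_set_scope.
Local Open Scope complex_scope.
Local Open Scope ring_scope.

Notation normc := ComplexField.Normc.normc.

Section SquareSummable.
Variable R : realType.
Implicit Types (f g : nat -> R[i]) (z w c : R[i]).

Lemma normc_ge0 z : 0 <= normc z.
Proof. by case: z => a b; exact: sqrtr_ge0. Qed.

Definition sqsum f : R^nat := series (fun n => normc (f n) ^+ 2).

Definition ell2_pred : {pred nat -> R[i]} := [pred f | `[< cvgn (sqsum f) >]].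

Lemma ell2P f : f \in ell2_pred <-> cvgn (sqsum f).
Proof. by rewrite unfold_in; split=> [/asboolP|h]; [|apply/asboolP]. Qed.

Definition ell2_norm f : R := Num.sqrt (limn (sqsum f)).

Lemma sqsum_ge0 f n : 0 <= sqsum f n.
Proof. by rewrite sumr_ge0// => i _; exact: sqr_ge0. Qed.

Lemma sqsum_nd f : {homo sqsum f : m n / (m <= n)%N >-> m <= n}.
Proof.
apply/nondecreasing_seqP => n; rewrite /sqsum /series/= big_nat_recr//=.
by rewrite lerDl sqr_ge0.
Qed.

Lemma sqsum_le_lim f n : cvgn (sqsum f) -> sqsum f n <= limn (sqsum f).
Proof. by move=> cf; apply: nondecreasing_cvgn_le => //; exact: sqsum_nd. Qed.

Lemma limn_sqsum_ge0 f : cvgn (sqsum f) -> 0 <= limn (sqsum f).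
Proof. by move=> cf; exact: le_trans (sqsum_ge0 f 0) (sqsum_le_lim 0 cf). Qed.

Lemma sqsum_bounded f (M : R) : (forall n, sqsum f n <= M) ->
  cvgn (sqsum f) /\ limn (sqsum f) <= M.
Proof.
move=> fM; have cf : cvgn (sqsum f).
  apply: nondecreasing_is_cvgn; first exact: sqsum_nd.
  by exists M => _ [n _ <-].
by split=> //; apply: limr_le => //; exact: nearW.
Qed.

Lemma minkowski2 (A B a b : R) : 0 <= A -> 0 <= B -> 0 <= a -> 0 <= b ->
  (A + B) ^+ 2 + (a + b) ^+ 2 <=
  (Num.sqrt (A ^+ 2 + a ^+ 2) + Num.sqrt (B ^+ 2 + b ^+ 2)) ^+ 2.
Proof.
move=> A0 B0 a0 b0.
have := le_normcD (Complex A a : Rcomplex R) (Complex B b : Rcomplex R).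
rewrite /= -(@ler_pXn2r _ 2)// ?nnegrE ?addr_ge0 ?sqrtr_ge0//.
by rewrite sqr_sqrtr ?addr_ge0 ?sqr_ge0.
Qed.

Lemma minkowski_sqsum f g n : sqsum (f + g) n <=
  (Num.sqrt (sqsum f n) + Num.sqrt (sqsum g n)) ^+ 2.
Proof.
elim: n => [|n ih].
  by rewrite /sqsum /series/= !big_geq// sqr_ge0.
have e h : sqsum h n.+1 = Num.sqrt (sqsum h n) ^+ 2 + normc (h n) ^+ 2.
  by rewrite sqr_sqrtr ?sqsum_ge0// /sqsum /series/= big_nat_recr.
rewrite [sqsum (f + g) _]/sqsum /series/= big_nat_recr//= (e f) (e g).
apply: le_trans _ (minkowski2 _ _ _ _); rewrite ?sqrtr_ge0 ?normc_ge0//.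
rewrite lerD// ler_pXn2r// ?nnegrE ?addr_ge0 ?normc_ge0//.
exact: le_normcD (f n : Rcomplex R) (g n).
Qed.

Lemma ell2D f g : f \in ell2_pred -> g \in ell2_pred ->
  cvgn (sqsum (f + g)) /\ ell2_norm (f + g) <= ell2_norm f + ell2_norm g.
Proof.
move=> /ell2P cf /ell2P cg.
have [] := @sqsum_bounded (f + g) ((ell2_norm f + ell2_norm g) ^+ 2).
  move=> n; apply: le_trans (minkowski_sqsum f g n) _.
  rewrite ler_pXn2r// ?nnegrE ?addr_ge0 ?sqrtr_ge0//.
  by apply: lerD; apply: ler_wsqrtr; exact: sqsum_le_lim.
move=> cfg le; split => //; rewrite -[leRHS]ger0_norm ?addr_ge0 ?sqrtr_ge0//.
by rewrite -sqrtr_sqr; exact: ler_wsqrtr.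
Qed.

Lemma sqsumZ c f : sqsum (c *: f) = (fun n => normc c ^+ 2 * sqsum f n).
Proof.
apply/funext => n; rewrite /sqsum /series/= mulr_sumr; apply: eq_bigr => i _.
by rewrite ComplexField.Normc.normcM exprMn.
Qed.

Lemma ell2Z c f : f \in ell2_pred ->
  cvgn (sqsum (c *: f)) /\ ell2_norm (c *: f) = normc c * ell2_norm f.
Proof.
move=> /ell2P cf.
have h : sqsum (c *: f) @ \oo --> normc c ^+ 2 * limn (sqsum f).
  by rewrite sqsumZ; apply: cvgM; [exact: cvg_cst|].
split; first by apply/cvg_ex; eexists; exact: h.
rewrite /ell2_norm (cvg_lim _ h)// sqrtrM ?sqr_ge0// sqrtr_sqr.
by rewrite ger0_norm ?normc_ge0.
Qed.

Lemma ell2_norm0_eq0 f : f \in ell2_pred -> ell2_norm f = 0 -> f = 0.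
Proof.
move=> /ell2P cf /eqP; rewrite sqrtr_eq0 => f0.
apply/funext => n; apply: ComplexField.Normc.eq0_normc; apply/eqP.
rewrite -sqrf_eq0 eq_le sqr_ge0 andbT.
have /le_trans := sqsum_le_lim n.+1 cf => /(_ _ f0).
rewrite /sqsum /series/= big_nat_recr//=; apply: le_trans.
by rewrite lerDr; exact: (sqsum_ge0 f n).
Qed.

Lemma ell2_basis_subproof (m : nat) :
  (fun n => (n == m)%:R : R[i]) \in ell2_pred.
Proof.
apply/ell2P.
have [] // := @sqsum_bounded (fun n => (n == m)%:R) 1 => n.
rewrite /sqsum /series/=.
have -> : \sum_(0 <= k < n) normc ((k == m)%:R : R[i]) ^+ 2 =
    \sum_(0 <= k < n) ((k == m)%:R : R).
  apply: eq_bigr => k _; case: (k == m).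
    by rewrite mulr1n ComplexField.Normc.normc1 expr1n.
  by rewrite mulr0n ComplexField.Normc.normc0 expr0n.
rewrite big_mkord -natr_sum -[leRHS](mulr1n 1) ler_nat.
elim: n => [|n ih]; first by rewrite big_ord0.
rewrite big_ord_recr/=; have [->|_] := eqVneq n m; last by rewrite addn0.
by rewrite big1// => i _; rewrite ltn_eqF.
Qed.

Lemma ell2_submod_closed : submod_closed ell2_pred.
Proof.
split=> [|c f g ef eg].
  apply/ell2P; have [] // := @sqsum_bounded 0 0 => n.
  rewrite /sqsum /series/= big1// => i _.
  by rewrite !expr0n/= addr0 sqrtr0 expr0n.
have [cf _] := ell2Z c ef; have cf' : c *: f \in ell2_pred.
  by apply/ell2P.
by have [cfg _] := ell2D cf' eg; apply/ell2P.
Qed.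

HB.instance Definition _ :=
  GRing.isSubmodClosed.Build R[i] (nat -> R[i]) ell2_pred ell2_submod_closed.

End SquareSummable.

(* l^2(N) over the complex numbers, as a normed module over R[i]. The index
   n : nat stands for the element n.+1 of N = {1, 2, 3, ...}. *)
Record ell2 (R : realType) := Ell2 {
  ell2_val :> nat -> R[i];
  _ : ell2_val \in @ell2_pred R }.

Section Ell2Structure.
Variable R : realType.

HB.instance Definition _ := [isSub for @ell2_val R].
HB.instance Definition _ := [Choice of ell2 R by <:].
HB.instance Definition _ := [SubChoice_isSubLmodule of ell2 R by <:].

Let norm (f : ell2 R) : R[i] := (ell2_norm f)%:C.

Let norm_triangle f g : norm (f + g) <= norm f + norm g.
Proof.
have [_ h] := ell2D (valP f) (valP g).
by rewrite /norm -rmorphD lecR.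
Qed.

Let normZ c f : norm (c *: f) = `|c| * norm f.
Proof.
by have [_ h] := ell2Z c (valP f); rewrite /norm h rmorphM.
Qed.

Let norm0_eq0 f : norm f = 0 -> f = 0.
Proof.
by case=> /(ell2_norm0_eq0 (valP f)) h; exact: val_inj.
Qed.

HB.instance Definition _ :=
  Lmodule_isNormed.Build R[i] (ell2 R) norm_triangle normZ norm0_eq0.

Lemma ell2_normE (f : ell2 R) : `|f| = (ell2_norm f)%:C.
Proof. by []. Qed.

End Ell2Structure.

Section Operators.
Variable R : realType.
Implicit Types (f g : ell2 R) (T S P : {linear ell2 R -> ell2 R}).

Definition ell2_basis (m : nat) : ell2 R := Ell2 (ell2_basis_subproof R m).

(* R[i]^o is R[i] with its norm topology. *)
Definition dotp f g : R[i] := limn (series (fun n => f n * (g n)^* : R[i]^o)).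

Definition bounded_operator T := exists M : R, forall f, `|T f| <= M%:C * `|f|.

Definition compact_operator T :=
  precompact [set T f | f in [set f : ell2 R | `|f| <= 1]].

Definition adjoint_of T S := forall f g, dotp (T f) g = dotp f (S g).

Definition positive_operator T := forall f, 0 <= dotp (T f) f.

(* P is |T|, the positive square root of T^* T. *)
Definition absolute_value_of T P :=
  [/\ bounded_operator P, positive_operator P &
    exists2 S, adjoint_of T S & forall f, P (P f) = S (T f)].

Definition trace_class_operator T :=
  exists2 P, absolute_value_of T P &
    cvgn (series (fun n => dotp (P (ell2_basis n)) (ell2_basis n) : R[i]^o)).

Implicit Types A : nat -> nat -> R[i].

Definition matrix_of T A := forall n m, T (ell2_basis m) n = A n m.

(* At most one bounded operator has a given matrix. *)
Definition bounded_matrix A :=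
  exists2 T, bounded_operator T & matrix_of T A.

Definition compact_matrix A :=
  exists T, [/\ bounded_operator T, matrix_of T A & compact_operator T].

Definition trace_class_matrix A :=
  exists T, [/\ bounded_operator T, matrix_of T A & trace_class_operator T].

Definition psd_matrix A :=
  forall (f : nat -> R[i]) (N : nat), (forall n, (N <= n)%N -> f n = 0) ->
    0 <= \sum_(n < N) \sum_(m < N) A n m * f n * (f m)^*.

Definition formally_rank_one A :=
  exists2 u : nat -> R[i], u <> 0 & forall n m, A n m = u n * u m.

(* Row n and column m of B(tau, rho) in the 1-based indexing are n.+1, m.+1. *)
Definition Bmatrix (tau rho : R) (n m : nat) : R[i] :=
  ((n.+1 * m.+1)%:R `^ (tau / 2) / (maxn n.+1 m.+1)%:R `^ tau
   * ((n.+1 * m.+1)%:R `^ (rho / 2))^-1)%:C.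

End Operators.

(* Main.v *)
From HB Require Import structures.
Require Import Defs.
From mathcomp Require Import all_boot all_order all_algebra.
From mathcomp Require Import complex.
From mathcomp Require Import ring lra.
From mathcomp Require Import all_classical all_reals all_analysis.
Set Implicit Arguments.
Unset Strict Implicit.
Unset Printing Implicit Defensive.
Import Order.TTheory GRing.Theory Num.Theory.
Import numFieldNormedType.Exports.
Local Open Scope classical_set_scope.
Local Open Scope complex_scope.
Local Open Scope ring_scope.
Local Notation Re := (@complex.Re _).
Local Notation Im := (@complex.Im _).

(** Write [t] for [tau], [r] for [rho] and count indices from 1.  The entries are
positive, and equal [(n m)^((t - r)/2) max(n,m)^(-t)].

Size.  If [t >= 0] then [(n m)^(t/2) <= max(n,m)^t], and if [t <= 0] then
[max(n,m)^(-t) <= (n m)^(-t)].  So the entries are dominated by a rank-one matrix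
[w_n w_m], where [w_n = n^(-s/2)] with [s = r] or [s = r + t] respectively.  For
[s > 1] the weight [w] lies in [l^2]: Schur's test with the weight [w]
([schur_operator]) gives a bounded operator, and it maps the unit ball into a
Hilbert cube, so it is compact ([rank_one_dominated_operator]).  For [r = 1] and
[t > 0], Schur's test with the weight [n^(-1/2)] gives boundedness
([bmat_operator_critical]).  Conversely the first column is [n^(-(t + r)/2)], and
it must be square-summable if the operator is bounded, which forces [t + r > 1];
this settles [t <= 0].  On the indices [N <= n, m < 2 N] all entries are at least
a constant times [N^(-r)], so the normalized indicator of this block is mapped to
a vector with norm at least a constant times [N^(1 - r)] on the same block
([block_vector_image]).  For [r < 1] this contradicts boundedness; for [r = 1] it
contradicts compactness, as these blocks escape to infinity.

Sign.  Let [x_n = n^((t - r)/2) f_n], with partial sums [X_N].  Summation by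
parts gives, for [h] nonincreasing,
[sum_(n,m <= N) h(max(n,m)) x_n conj(x_m) >= h(N) |X_N|^2] ([max_form_ge]).  With
[h(n) = n^(-t)] and [t > 0] this is positivity; then [|T| = T] and the trace is
[sum n^(-r)].  With [h(n) = - n^(-t)] and [t < 0] it bounds the form of [T] from
above by the limit of [N^(-t) |X_N|^2], which is zero when [f] is orthogonal to
the vector [n^((t - r)/2)] ([bmat_negative_form]).

Trace class for [t < 0].  The form of [T] is nonpositive on a hyperplane, and it
is positive at the first basis vector.  Hence [T] has exactly one positive
eigenvalue [l], with a unit eigenvector [phi] ([top_eigenvector]), and the form is
nonpositive on the orthogonal complement of [phi].  So
[|T| f = 2 l <f, phi> phi - T f] ([absolute_value_exists]): no general square root
of operators is needed, and the trace of [|T|] is [2 l - sum n^(-r)], a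
convergent series. *)

(** * Series of complex numbers *)

Lemma cvg_eq (T : topologicalType) (u v : nat -> T) (l : T) :
  (forall n, u n = v n) -> u @ \oo --> l -> v @ \oo --> l.
Proof. by move=> /funext ->. Qed.

Section ComplexSeries.
Variable R : realType.
Implicit Types (z w : R[i]) (x : R).

Lemma normcD z w : normc (z + w) <= normc z + normc w.
Proof. exact: (@le_normcD R z w). Qed.

Lemma normc_opp z : normc (- z) = normc z.
Proof. exact: (@normcN R z). Qed.

Lemma normC_normc z : `|z| = (normc z)%:C.
Proof. by rewrite normc_def; case: z. Qed.

Lemma norm_regularE (z : R[i]^o) : `|z| = (normc z)%:C.
Proof. exact: normC_normc. Qed.

Lemma normc_real x : normc x%:C = `|x|.
Proof. by rewrite /= expr0n/= addr0 sqrtr_sqr. Qed.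

Lemma normc_conj z : normc z^* = normc z.
Proof. by apply: complexI; rewrite -!normC_normc norm_conjC. Qed.

Lemma mul_conj z : z * z^* = (normc z ^+ 2)%:C.
Proof. by rewrite -normCK normC_normc rmorphXn. Qed.

Lemma normc_sum (I : Type) (r : seq I) (P : pred I) (F : I -> R[i]) :
  normc (\sum_(i <- r | P i) F i) <= \sum_(i <- r | P i) normc (F i).
Proof.
elim/big_ind2 : _ => [|a b c d ha hc|//]; first by rewrite ComplexField.Normc.normc0.
exact: le_trans (normcD _ _) (lerD ha hc).
Qed.

Lemma conj_real x : (x%:C)^* = x%:C.
Proof. by apply: conj_Creal; rewrite complex_real. Qed.

Lemma Re_le_normc z : `|Re z| <= normc z.
Proof. by rewrite -lecR -normC_normc; exact: normc_ge_Re. Qed.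

Lemma Im_le_normc z : `|Im z| <= normc z.
Proof.
case: z => a b /=; rewrite -[leLHS]sqrtr_sqr ler_wsqrtr// lerDr; exact: sqr_ge0.
Qed.

Lemma normc_le_ReIm z : normc z <= `|Re z| + `|Im z|.
Proof.
case: z => a b /=; rewrite -[leRHS]ger0_norm ?addr_ge0// -sqrtr_sqr ler_wsqrtr//.
by rewrite sqrrD !real_normK ?num_real// lerD2r lerDl mulrn_wge0 ?mulr_ge0.
Qed.

Lemma gt0_complexP (e : R[i]) : 0 < e -> exists2 x, 0 < x & e = x%:C.
Proof.
by case: e => a b; rewrite ltcE/= => /andP[/eqP-> a0]; exists a.
Qed.

(** Radii of balls in [R[i]] are positive elements of [R[i]], hence real. *)
Lemma cvg_normcP (u : nat -> R[i]) z :
  (u : nat -> R[i]^o) @ \oo --> (z : R[i]^o) <->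
  (fun n => normc (u n - z)) @ \oo --> (0 : R).
Proof.
split=> [/cvgrPdist_lt h|/cvgrPdist_lt h].
  apply/cvgrPdist_lt => e e0.
  have /h : 0 < (e%:C : R[i]) by rewrite ltcR.
  apply: filterS => n; rewrite norm_regularE ltcR -normc_opp opprB => h'.
  by rewrite sub0r normrN ger0_norm ?normc_ge0.
apply/cvgrPdist_lt => _ /gt0_complexP[e e0 ->].
have /h := e0; apply: filterS => n; rewrite sub0r normrN ger0_norm ?normc_ge0//.
by rewrite norm_regularE ltcR -normc_opp opprB.
Qed.

(** A complex series whose terms have summable moduli converges, because its
real and imaginary parts do. *)
Lemma abs_summable_cvg (f : nat -> R[i]) : cvgn (series (fun n => normc (f n))) ->
  cvgn (series (f : nat -> R[i]^o)).
Proof.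
move=> cf.
have cRe : cvgn (series (fun n => Re (f n))).
  apply: normed_cvg; apply: series_le_cvg cf => n //=; last exact: Re_le_normc.
  exact: normc_ge0.
have cIm : cvgn (series (fun n => Im (f n))).
  apply: normed_cvg; apply: series_le_cvg cf => n //=; last exact: Im_le_normc.
  exact: normc_ge0.
apply/cvg_ex; exists (Complex (limn (series (fun n => Re (f n))))
  (limn (series (fun n => Im (f n))))); apply/cvg_normcP.
have h : (fun n => `|series (fun n => Re (f n)) n - limn (series (fun n => Re (f n)))| +
   `|series (fun n => Im (f n)) n - limn (series (fun n => Im (f n)))|) @ \oo --> (0:R).
  rewrite -[0 : R]addr0; apply: cvgD.
    rewrite -[X in _ --> X](normr0 R) -(subrr (limn (series (fun n => Re (f n))))).
    by apply: cvg_norm; apply: cvgB => //; exact: cvg_cst.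
  rewrite -[X in _ --> X](normr0 R) -(subrr (limn (series (fun n => Im (f n))))).
  by apply: cvg_norm; apply: cvgB => //; exact: cvg_cst.
apply: squeeze_cvgr (cvg_cst 0) h; apply: nearW => n; rewrite normc_ge0/=.
apply: le_trans (normc_le_ReIm _) _; rewrite !raddfB/=.
by rewrite !raddf_sum.
Qed.

Lemma nneg_series_cvg (u : nat -> R) (M : R) : (forall n, 0 <= u n) ->
  (forall N, \sum_(k < N) u k <= M) -> cvgn (series u).
Proof.
move=> u0 uM; apply: nondecreasing_is_cvgn.
  apply/nondecreasing_seqP => n; rewrite /series/= big_nat_recr//=.
  by rewrite lerDl.
by exists M => _ [n _ <-]; rewrite /series/= big_mkord.
Qed.

Lemma nneg_series_le_lim (u : nat -> R) N : (forall n, 0 <= u n) ->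
  cvgn (series u) -> \sum_(k < N) u k <= limn (series u).
Proof.
move=> u0 cu; rewrite -(big_mkord xpredT u); apply: (@nondecreasing_cvgn_le _ (series u)) => //.
by apply/nondecreasing_seqP => n; rewrite /series/= big_nat_recr//= lerDl.
Qed.

Lemma nneg_series_tail_le (u : nat -> R) N K : (forall n, 0 <= u n) ->
  cvgn (series u) -> \sum_(N <= k < K) u k <= limn (series u) - series u N.
Proof.
move=> u0 cu; rewrite lerBrDl; have [KN|/ltnW NK] := leqP K N.
  by rewrite [X in _ + X]big_geq// addr0 /series/= big_mkord nneg_series_le_lim.
by rewrite /series/= -big_cat_nat//= big_mkord nneg_series_le_lim.
Qed.

Lemma complex_cvg_unique (u : nat -> R[i]) z w :
  (u : nat -> R[i]^o) @ \oo --> (z : R[i]^o) ->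
  (u : nat -> R[i]^o) @ \oo --> (w : R[i]^o) -> z = w.
Proof. exact: (@cvg_unique R[i]^o (@norm_hausdorff _ _)). Qed.

Lemma normc_lim_le (u : nat -> R[i]) z (M : R) :
  (u : nat -> R[i]^o) @ \oo --> (z : R[i]^o) ->
  (forall n, normc (u n) <= M) -> normc z <= M.
Proof.
move=> /cvg_normcP uz uM; apply/ler_addgt0Pr => e e0.
move/cvgrPdist_lt : uz => /(_ _ e0)[N _ /(_ N (leqnn N))].
rewrite sub0r normrN ger0_norm ?normc_ge0// => h.
have -> : z = u N + - (u N - z) by rewrite opprB addrC subrK.
by apply: le_trans (normcD _ _) _; rewrite normc_opp lerD// ltW.
Qed.

(** By induction on [N], where the new cross term is bounded by the inequality of
arithmetic and geometric means. *)
Lemma cauchy_schwarz_sum (a b : nat -> R) N :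
  (\sum_(k < N) a k * b k) ^+ 2 <=
  (\sum_(k < N) a k ^+ 2) * (\sum_(k < N) b k ^+ 2).
Proof.
elim: N => [|N ih]; first by rewrite !big_ord0 expr0n mul0r.
rewrite !big_ord_recr/=.
set S := \sum_(k < N) _ in ih *; set A := \sum_(k < N) _ in ih *.
set B := \sum_(k < N) _ in ih *.
have A0 : 0 <= A by apply: sumr_ge0 => k _; exact: sqr_ge0.
have B0 : 0 <= B by apply: sumr_ge0 => k _; exact: sqr_ge0.
suff : 2 * S * (a N * b N) <= A * b N ^+ 2 + a N ^+ 2 * B.
  move=> h; rewrite -subr_ge0.
  have -> : (A + a N ^+ 2) * (B + b N ^+ 2) - (S + a N * b N) ^+ 2 =
    (A * B - S ^+ 2) + (A * b N ^+ 2 + a N ^+ 2 * B - 2 * S * (a N * b N)) by ring.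
  by rewrite addr_ge0 ?subr_ge0.
have t0 : 0 <= A * b N ^+ 2 + a N ^+ 2 * B.
  by apply: addr_ge0; apply: mulr_ge0 => //; exact: sqr_ge0.
rewrite -[leRHS]ger0_norm//; apply: le_trans (ler_norm _) _.
rewrite -ler_sqr ?nnegrE// !real_normK ?num_real//.
have -> : (2 * S * (a N * b N)) ^+ 2 = 4 * S ^+ 2 * (a N * b N) ^+ 2 by ring.
apply: (@le_trans _ _ (4 * (A * B) * (a N * b N) ^+ 2)).
  by rewrite ler_wpM2r ?sqr_ge0// ler_wpM2l.
rewrite -subr_ge0.
have -> : (A * b N ^+ 2 + a N ^+ 2 * B) ^+ 2 - 4 * (A * B) * (a N * b N) ^+ 2 =
  (A * b N ^+ 2 - a N ^+ 2 * B) ^+ 2 by ring.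
exact: sqr_ge0.
Qed.

End ComplexSeries.

(** * Geometry of the sequence space *)

Section Ell2Geometry.
Variable R : realType.
Implicit Types (f g h : ell2 R) (c : R[i]) (N : nat).

Lemma ell2_addE f g n : (f + g) n = f n + g n. Proof. by []. Qed.
Lemma ell2_oppE f n : (- f) n = - f n. Proof. by []. Qed.
Lemma ell2_scaleE c f n : (c *: f) n = c * f n. Proof. by []. Qed.

Lemma ell2_sumE (I : Type) (r : seq I) (P : pred I) (F : I -> ell2 R) n :
  (\sum_(i <- r | P i) F i) n = \sum_(i <- r | P i) F i n.
Proof. by elim/big_ind2 : _ => // a b c d <- <-. Qed.

Lemma ell2_norm_ge0 f : 0 <= ell2_norm f. Proof. exact: sqrtr_ge0. Qed.

Lemma sqsum_cvg f : cvgn (sqsum f). Proof. by apply/ell2P; exact: valP f. Qed.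

Lemma sqsumE (u : nat -> R[i]) N : sqsum u N = \sum_(k < N) normc (u k) ^+ 2.
Proof. by rewrite /sqsum /series/= big_mkord. Qed.

Lemma ell2_norm_sqr f : ell2_norm f ^+ 2 = limn (sqsum f).
Proof. by rewrite sqr_sqrtr// limn_sqsum_ge0//; exact: sqsum_cvg. Qed.

Lemma sum_le_ell2_norm f N : \sum_(k < N) normc (f k) ^+ 2 <= ell2_norm f ^+ 2.
Proof. by rewrite ell2_norm_sqr -sqsumE; apply: sqsum_le_lim; exact: sqsum_cvg. Qed.

Lemma coord_le_ell2_norm f n : normc (f n) <= ell2_norm f.
Proof.
rewrite -ler_sqr ?nnegrE ?normc_ge0 ?ell2_norm_ge0//.
apply: le_trans (sum_le_ell2_norm f n.+1); rewrite big_ord_recr/= lerDr.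
by apply: sumr_ge0 => i _; exact: sqr_ge0.
Qed.

Lemma ell2_norm_sqr_le f (M : R) :
  (forall N, \sum_(k < N) normc (f k) ^+ 2 <= M) -> ell2_norm f ^+ 2 <= M.
Proof.
move=> h; rewrite ell2_norm_sqr.
by have [] := @sqsum_bounded _ f M (fun N => _ (h N)) => [N|]; rewrite ?sqsumE.
Qed.

Lemma ell2_norm_le f (M : R) : 0 <= M ->
  (forall N, \sum_(k < N) normc (f k) ^+ 2 <= M ^+ 2) -> ell2_norm f <= M.
Proof.
by move=> M0 h; rewrite -ler_sqr ?nnegrE ?ell2_norm_ge0//; exact: ell2_norm_sqr_le.
Qed.

Lemma ell2_normD f g : ell2_norm (f + g)%R <= ell2_norm f + ell2_norm g.
Proof. by have [] := ell2D (valP f) (valP g). Qed.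

Lemma ell2_normZ c f : ell2_norm (c *: f)%R = normc c * ell2_norm f.
Proof. by have [] := ell2Z c (valP f). Qed.

Lemma ell2_normN f : ell2_norm (- f)%R = ell2_norm f.
Proof. by rewrite -scaleN1r ell2_normZ normc_opp ComplexField.Normc.normc1 mul1r. Qed.

Lemma ell2_normB f g : ell2_norm (f - g)%R <= ell2_norm f + ell2_norm g.
Proof. by rewrite -(ell2_normN g); exact: ell2_normD. Qed.

Lemma ell2_norm0 : ell2_norm (0 : ell2 R) = 0.
Proof. by rewrite -(scale0r (0 : ell2 R)) ell2_normZ ComplexField.Normc.normc0 mul0r. Qed.

Lemma ell2_norm_eq0 f : ell2_norm f = 0 -> f = 0.
Proof. by move/(ell2_norm0_eq0 (valP f)) => h; exact: val_inj. Qed.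

Lemma sum_normc_le f g N :
  \sum_(k < N) normc (f k * (g k)^* ) <= ell2_norm f * ell2_norm g.
Proof.
under eq_bigr do rewrite ComplexField.Normc.normcM normc_conj.
rewrite -ler_sqr ?nnegrE ?mulr_ge0 ?ell2_norm_ge0//; last first.
  by apply: sumr_ge0 => k _; rewrite mulr_ge0 ?normc_ge0.
apply: le_trans (cauchy_schwarz_sum (fun k => normc (f k))
  (fun k => normc (g k)) N) _; rewrite exprMn.
by apply: ler_pM; rewrite ?sum_le_ell2_norm// sumr_ge0// => k _; exact: sqr_ge0.
Qed.

Lemma dotp_cvg f g :
  series (fun n => f n * (g n)^* : R[i]^o) @ \oo --> (dotp f g : R[i]^o).
Proof.
apply: abs_summable_cvg; apply: (@nneg_series_cvg _ _ (ell2_norm f * ell2_norm g)).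
  by move=> n; exact: normc_ge0.
by move=> N; exact: sum_normc_le.
Qed.

Lemma dotp_unique f g c :
  series (fun n => f n * (g n)^* : R[i]^o) @ \oo --> (c : R[i]^o) -> dotp f g = c.
Proof. exact: cvg_lim. Qed.

Lemma cauchy_schwarz f g : normc (dotp f g) <= ell2_norm f * ell2_norm g.
Proof.
apply: (@normc_lim_le R (series (fun n => f n * (g n)^* : R[i])) _ _ _ _) => [|n].
  exact: dotp_cvg.
rewrite /series/= big_mkord.
exact: le_trans (normc_sum _ _ _) (sum_normc_le f g n).
Qed.

Lemma dotpDl f g h : dotp (f + g)%R h = dotp f h + dotp g h.
Proof.
apply: dotp_unique; apply: cvg_eq (cvgD (@dotp_cvg f h) (@dotp_cvg g h)) => n.
rewrite /= /series/= -[LHS]big_split/=.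
by apply: eq_bigr => k _; rewrite -mulrDl.
Qed.

Lemma dotpZl c f h : dotp (c *: f)%R h = c * dotp f h.
Proof.
apply: dotp_unique.
apply: cvg_eq (cvgZr (k := c) (@dotp_cvg f h)) => n.
rewrite /= /series/= [LHS]mulr_sumr.
by apply: eq_bigr => k _; rewrite mulrA.
Qed.

Lemma dotp_conj f g : (dotp f g)^* = dotp g f.
Proof.
apply/esym/dotp_unique/cvg_normcP; have /cvg_normcP := @dotp_cvg f g.
apply: cvg_eq => n; rewrite -[LHS]normc_conj rmorphB /series/= rmorph_sum/=.
by congr (normc (_ - _)); apply: eq_bigr => k _; rewrite rmorphM/= conjCK mulrC.
Qed.

Lemma dotpDr f g h : dotp h (f + g)%R = dotp h f + dotp h g.
Proof. by rewrite -dotp_conj dotpDl rmorphD/= !dotp_conj. Qed.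

Lemma dotpZr c f h : dotp h (c *: f)%R = c^* * dotp h f.
Proof. by rewrite -dotp_conj dotpZl rmorphM/= dotp_conj. Qed.

Lemma dotpNl f h : dotp (- f)%R h = - dotp f h.
Proof. by rewrite -scaleN1r dotpZl mulN1r. Qed.

Lemma dotpNr f h : dotp h (- f)%R = - dotp h f.
Proof. by rewrite -dotp_conj dotpNl rmorphN/= dotp_conj. Qed.

Lemma dotpBl f g h : dotp (f - g)%R h = dotp f h - dotp g h.
Proof. by rewrite dotpDl dotpNl. Qed.

Lemma dotpBr f g h : dotp h (f - g)%R = dotp h f - dotp h g.
Proof. by rewrite dotpDr dotpNr. Qed.

Lemma dotp_self f : dotp f f = (ell2_norm f ^+ 2)%:C.
Proof.
apply: dotp_unique; apply/cvg_normcP; rewrite ell2_norm_sqr.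
have := @sqsum_cvg f; set l := limn _ => cl.
have {}cl : (fun n => `|sqsum f n - l|) @ \oo --> (0 : R).
  rewrite -[X in _ --> X](normr0 R) -(subrr l).
  by apply: cvg_norm; apply: cvgB => //; exact: cvg_cst.
apply: cvg_eq cl => n; rewrite -normc_real rmorphB; congr (normc (_ - _)).
rewrite /sqsum /series rmorph_sum.
by apply: eq_bigr => k _; rewrite mul_conj.
Qed.

Lemma ell2_basisE m n : ell2_basis R m n = (n == m)%:R. Proof. by []. Qed.

Lemma dotp_basisr f n : dotp f (ell2_basis R n) = f n.
Proof.
apply: dotp_unique; apply: (@cvg_trans _ (cst (f n : R[i]^o) @ \oo)); last exact: cvg_cst.
apply: near_eq_cvg; exists n.+1 => // k /= nk.
rewrite /series/= big_mkord (bigD1 (Ordinal nk))//= eqxx conjC1 mulr1 big1 ?addr0//.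
by move=> i /negPf ni; rewrite -[_ == n]/(i == Ordinal nk) ni conjC0 mulr0.
Qed.

Lemma ell2_norm_basis n : ell2_norm (ell2_basis R n) = 1.
Proof.
have h : (ell2_norm (ell2_basis R n) ^+ 2)%:C = 1%:C :> R[i].
  by rewrite -dotp_self dotp_basisr ell2_basisE eqxx.
by move/complexI : h => /eqP; rewrite sqrp_eq1 ?ell2_norm_ge0// => /eqP.
Qed.

Definition truncation N f : ell2 R := \sum_(m < N) f m *: ell2_basis R m.

Lemma truncationE N f n : truncation N f n = if (n < N)%N then f n else 0.
Proof.
rewrite /truncation ell2_sumE.
under eq_bigr do rewrite ell2_scaleE ell2_basisE.
case: ifPn => nN.
  rewrite (bigD1 (Ordinal nN))//= eqxx mulr1 big1 ?addr0// => i /negPf ni.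
  by rewrite eq_sym -[_ == n]/(i == Ordinal nN) ni mulr0.
rewrite big1// => i _; case: eqP => [e|]; last by rewrite mulr0.
by move: nN; rewrite e ltn_ord.
Qed.

Lemma truncation_norm_le N f : ell2_norm (truncation N f) <= ell2_norm f.
Proof.
apply: ell2_norm_le => [|K]; first exact: ell2_norm_ge0.
apply: le_trans (sum_le_ell2_norm f K); apply: ler_sum => k _.
rewrite truncationE; case: ifP => // _.
by rewrite ComplexField.Normc.normc0 expr0n/= sqr_ge0.
Qed.

Lemma truncation_cvg f : (fun N => ell2_norm (f - truncation N f)%R) @ \oo --> (0 : R).
Proof.
have h : (fun N => Num.sqrt (limn (sqsum f) - sqsum f N)) @ \oo --> (0 : R).
  have h0 : (fun N => limn (sqsum f) - sqsum f N) @ \oo --> (0 : R).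
    rewrite -[X in _ --> X](subrr (limn (sqsum f))).
    by apply: cvgB; [exact: cvg_cst|exact: sqsum_cvg].
  rewrite -[X in _ --> X]sqrtr0.
  exact: (cvg_comp _ _ h0 (@sqrt_continuous R 0)).
apply: squeeze_cvgr (cvg_cst 0) h; apply: nearW => N; rewrite ell2_norm_ge0/=.
have d0 : 0 <= limn (sqsum f) - sqsum f N.
  by rewrite subr_ge0; apply: sqsum_le_lim; exact: sqsum_cvg.
apply: (@ell2_norm_le (f - truncation N f)%R) => [|K]; first exact: sqrtr_ge0.
rewrite sqr_sqrtr// lerBrDr.
apply: le_trans (@sqsum_le_lim _ _ (maxn K N) (@sqsum_cvg f)).
pose F k := normc (f k) ^+ 2; pose G k := normc ((f - truncation N f)%R k) ^+ 2.
have FG k : (N <= k)%N -> G k = F k.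
  by move=> Nk; rewrite /G ell2_addE ell2_oppE truncationE ltnNge Nk/= subr0.
have G0 k : (k < N)%N -> G k = 0.
  move=> Nk; rewrite /G ell2_addE ell2_oppE truncationE Nk subrr.
  by rewrite ComplexField.Normc.normc0 expr0n.
have eF M : sqsum f M = \sum_(0 <= k < M) F k by [].
have -> : \sum_(k < K) normc ((f - truncation N f)%R k) ^+ 2 = \sum_(0 <= k < K) G k.
  by rewrite big_mkord.
rewrite !eF.
rewrite [leRHS](big_cat_nat (n := N))//= ?leq_maxr// [leLHS]addrC lerD2l.
apply: (@le_trans _ _ (\sum_(0 <= k < maxn K N) G k)).
  rewrite [leRHS](big_cat_nat (n := K))//= ?leq_maxl// lerDl.
  by apply: sumr_ge0 => k _; exact: sqr_ge0.
rewrite (big_cat_nat (n := N))//= ?leq_maxr// big_nat big1 ?add0r.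
  by rewrite big_nat [leRHS]big_nat; apply: ler_sum => k /andP[Nk _]; rewrite FG.
by move=> k /andP[_ kN]; rewrite G0.
Qed.

Implicit Type T : {linear ell2 R -> ell2 R}.

Lemma bounded_operatorP T : bounded_operator T ->
  exists2 M : R, 0 <= M & forall f, ell2_norm (T f) <= M * ell2_norm f.
Proof.
move=> [M hM]; exists `|M| => // f; have := hM f.
rewrite !ell2_normE -rmorphM/= lecR => /le_trans; apply.
by rewrite ler_wpM2r ?ell2_norm_ge0 ?ler_norm.
Qed.

Lemma bounded_operator_intro T (M : R) :
  (forall f, ell2_norm (T f) <= M * ell2_norm f) -> bounded_operator T.
Proof. by move=> h; exists M => f; rewrite !ell2_normE -rmorphM/= lecR. Qed.

Lemma truncation_image T A N f n : matrix_of T A ->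
  T (truncation N f) n = \sum_(m < N) A n m * f m.
Proof.
move=> TA; rewrite /truncation linear_sum ell2_sumE; apply: eq_bigr => m _.
by rewrite linearZ ell2_scaleE TA mulrC.
Qed.

Lemma dotp_truncationr N f g : dotp f (truncation N g) = \sum_(n < N) f n * (g n)^*.
Proof.
rewrite -dotp_conj /truncation.
elim: N => [|N ih]; last first.
  by rewrite !big_ord_recr/= dotpDl dotpZl rmorphD/= ih rmorphM/= dotp_conj dotp_basisr mulrC.
rewrite !big_ord0 dotp_conj.
by have := @dotpZr 0 0 f; rewrite scale0r conjC0 mul0r.
Qed.

(** The quadratic form of a bounded operator is the limit of those of its
finite sections, so symmetry and sign conditions can be read off the matrix. *)
Lemma form_cvg T A f g : bounded_operator T -> matrix_of T A ->
  (fun N => \sum_(n < N) \sum_(m < N) A n m * f m * (g n)^* : R[i]^o) @ \oo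
    --> (dotp (T f) g : R[i]^o).
Proof.
move=> /bounded_operatorP[M M0 hM] TA; apply/cvg_normcP.
have e N : \sum_(n < N) \sum_(m < N) A n m * f m * (g n)^* =
    dotp (T (truncation N f)) (truncation N g).
  rewrite dotp_truncationr; apply: eq_bigr => n _.
  by rewrite (truncation_image _ _ _ TA) mulr_suml.
have h : (fun N => M * ell2_norm (f - truncation N f)%R * ell2_norm g +
   M * ell2_norm f * ell2_norm (g - truncation N g)%R) @ \oo --> (0 : R).
  have -> : 0 = M * 0 * ell2_norm g + M * ell2_norm f * 0 :> R.
    by rewrite !mulr0 mul0r addr0.
  apply: cvgD; first apply: cvgM; first apply: cvgM; try exact: cvg_cst.
    exact: truncation_cvg.
  by apply: cvgM; [exact: cvg_cst|exact: truncation_cvg].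
apply: squeeze_cvgr (cvg_cst 0) h; apply: nearW => N; rewrite normc_ge0/= e.
rewrite -normc_opp opprB.
have -> : dotp (T f) g - dotp (T (truncation N f)) (truncation N g) =
  dotp (T (f - truncation N f)) (truncation N g) + dotp (T f) (g - truncation N g)%R.
  by rewrite dotpBr linearB/= dotpBl; ring.
apply: le_trans (normcD _ _) _; apply: lerD.
  apply: le_trans (cauchy_schwarz _ _) _; apply: ler_pM => //; rewrite ?ell2_norm_ge0//.
  exact: truncation_norm_le.
apply: le_trans (cauchy_schwarz _ _) _.
by rewrite ler_wpM2r ?ell2_norm_ge0.
Qed.

Lemma symmetric_operator T A : bounded_operator T -> matrix_of T A ->
  (forall n m, A n m = (A m n)^* ) -> adjoint_of T T.
Proof.
move=> bT TA sA f g; rewrite -[RHS]dotp_conj.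
apply: complex_cvg_unique (@form_cvg T A f g bT TA) _; apply/cvg_normcP.
have /cvg_normcP := @form_cvg T A g f bT TA; apply: cvg_eq => N; rewrite -[LHS]normc_conj rmorphB/=; congr (normc (_ - _)).
rewrite exchange_big rmorph_sum/=; apply: eq_bigr => n _.
rewrite rmorph_sum/=; apply: eq_bigr => m _.
by rewrite !rmorphM/= conjCK -(sA n m) -!mulrA [(_)^* * _]mulrC.
Qed.

End Ell2Geometry.

(** * Compactness of the Hilbert cube *)

Section CompactOperators.
Variable R : realType.
Implicit Types (f g h : ell2 R) (w : nat -> R).

Lemma ultra_bounded_cvg (T : Type) (F : set_system T) (phi : T -> R) (a b : R) :
  UltraFilter F -> F [set x | a <= phi x <= b] ->
  exists l : R, phi x @[x --> F] --> l.
Proof.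
move=> UF Fab; have PF : ProperFilter F by exact: ultra_proper.
have [l [_ cl]] : `[a, b] `&` cluster (phi x @[x --> F]) !=set0.
  apply: (@segment_compact R a b).
  suff : F (phi @^-1` `[a, b]) by [].
  by apply: filterS Fab => x /=; rewrite in_itv.
exists l => U nU.
have [//|FnU] := in_ultra_setVsetC (phi @^-1` U) UF.
have [y [/= nUy Uy]] := cl (~` U) U FnU nU.
by case: (nUy).
Qed.

Definition hilbert_cube w : set (ell2 R) := [set g | forall n, normc (g n) <= w n].

Lemma sqr_normc_ReIm (z : R[i]) : normc z ^+ 2 = Re z ^+ 2 + Im z ^+ 2.
Proof. by case: z => x y /=; rewrite sqr_sqrtr// addr_ge0// sqr_ge0. Qed.

Lemma cvg_sumr (T : Type) (F : set_system T) (N : nat) (u : nat -> T -> R)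
  (l : nat -> R) : Filter F -> (forall k, u k x @[x --> F] --> l k) ->
  \sum_(k < N) u k x @[x --> F] --> \sum_(k < N) l k.
Proof. by move=> FF h; apply: cvg_big => [|i _]; [exact: add_continuous|exact: h]. Qed.

(** An ultrafilter on the Hilbert cube converges in every coordinate, and the
square-summable bound on the tails turns this into convergence in norm. *)
Lemma compact_hilbert_cube w : cvgn (series (fun n => w n ^+ 2)) ->
  compact (hilbert_cube w).
Proof.
move=> cw; rewrite compact_ultra => F UF FQ.
have PF : ProperFilter F by exact: ultra_proper.
have cRe n : exists l : R, Re (ell2_val h n) @[h --> F] --> l.
  apply: (@ultra_bounded_cvg _ F _ (- w n) (w n)) => //.
  by apply: filterS FQ => h Qh /=; rewrite -ler_norml; exact: le_trans (Re_le_normc _) (Qh n).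
have cIm n : exists l : R, Im (ell2_val h n) @[h --> F] --> l.
  apply: (@ultra_bounded_cvg _ F _ (- w n) (w n)) => //.
  by apply: filterS FQ => h Qh /=; rewrite -ler_norml; exact: le_trans (Im_le_normc _) (Qh n).
have [r rP] := choice cRe; have [s sP] := choice cIm.
pose g n : R[i] := Complex (r n) (s n).
have w0 n : 0 <= w n.
  by have [h Qh] := filter_ex FQ; exact: le_trans (normc_ge0 _) (Qh n).
have gw n : normc (g n) <= w n.
  rewrite -ler_sqr ?nnegrE ?normc_ge0// sqr_normc_ReIm/=.
  have h : (Re (ell2_val h n) ^+ 2 + Im (ell2_val h n) ^+ 2) @[h --> F] -->
      r n ^+ 2 + s n ^+ 2.
    by apply: cvgD; apply: cvgM.
  rewrite -(cvg_lim _ h)//; apply: limr_le; first by apply/cvg_ex; eexists; exact: h.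
  by apply: filterS FQ => k Qk; rewrite -sqr_normc_ReIm ler_sqr ?nnegrE ?normc_ge0.
have gl : g \in @ell2_pred R.
  apply/ell2P; apply: series_le_cvg cw => n; try exact: sqr_ge0.
  by rewrite ler_sqr ?nnegrE ?normc_ge0 ?gw.
exists (Ell2 gl); split; first exact: gw.
apply/(@cvgrPdist_lt _ _ _ F _ id) => _ /gt0_complexP[e e0 ->].
have e2 : 0 < e ^+ 2 / 2 by rewrite divr_gt0 ?exprn_gt0.
pose W := series (fun n => w n ^+ 2); have e8 : 0 < e ^+ 2 / 2 / 4 by rewrite divr_gt0.
have /cvgrPdist_lt/(_ _ e8)[N _ /(_ N (leqnn N)) hN] : W @ \oo --> limn W by exact: cw.
have {hN} tN := le_lt_trans (ler_norm _) hN.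
have h : (\sum_(k < N) ((Re (ell2_val h k) - r k) ^+ 2 + (Im (ell2_val h k) - s k) ^+ 2))
    @[h --> F] --> \sum_(k < N) (0 : R).
  apply: (@cvg_sumr _ F N (fun k h => (Re (ell2_val h k) - r k) ^+ 2 +
     (Im (ell2_val h k) - s k) ^+ 2) (fun=> 0)) => k.
  have -> : 0 = (r k - r k) ^+ 2 + (s k - s k) ^+ 2 :> R by rewrite !subrr expr0n addr0.
  apply: cvgD; apply: cvgM; apply: cvgB; (exact: rP || exact: sP || exact: cvg_cst).
rewrite big1// in h.
move/cvgrPdist_lt : h => /(_ _ e2); apply: filterS2 FQ => h Qh.
rewrite sub0r normrN ger0_norm; last first.
  by apply: sumr_ge0 => k _; rewrite addr_ge0// sqr_ge0.
move=> hd; rewrite ell2_normE ltcR -ltr_sqr ?nnegrE ?ell2_norm_ge0 ?(ltW e0)//.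
set d := (Ell2 gl - h)%R.
have dE k : normc (d k) ^+ 2 = (Re (h k) - r k) ^+ 2 + (Im (h k) - s k) ^+ 2.
  rewrite ell2_addE ell2_oppE sqr_normc_ReIm !raddfB/=.
  by rewrite -[in LHS]sqrrN opprB -[X in _ + X = _]sqrrN opprB.
have dw k : normc (d k) ^+ 2 <= 4 * w k ^+ 2.
  have -> : 4 * w k ^+ 2 = (w k + w k) ^+ 2 by ring.
  rewrite ler_sqr ?nnegrE ?normc_ge0 ?addr_ge0//.
  apply: le_trans (normcD _ _) _; apply: lerD; first exact: gw.
  by rewrite normc_opp; exact: Qh.
pose D := \sum_(k < N) normc (d k) ^+ 2.
have D2 : D < e ^+ 2 / 2 by rewrite /D; under eq_bigr do rewrite dE.
apply: (@le_lt_trans _ _ (D + 4 * (limn W - W N))); last first.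
  rewrite [ltRHS](splitr (e ^+ 2)) ltrD//.
  by rewrite mulrC -ltr_pdivlMr.
apply: ell2_norm_sqr_le => K.
apply: (@le_trans _ _ (\sum_(0 <= k < maxn K N) normc (d k) ^+ 2)).
  rewrite -(big_mkord xpredT (fun k => normc (d k) ^+ 2)).
  rewrite [leRHS](big_cat_nat (n := K))//= ?leq_maxl// lerDl.
  by apply: sumr_ge0 => k _; exact: sqr_ge0.
rewrite (big_cat_nat (n := N))//= ?leq_maxr// big_mkord lerD2l.
apply: (@le_trans _ _ (\sum_(N <= k < maxn K N) 4 * w k ^+ 2)).
  by apply: ler_sum => k _; exact: dw.
rewrite -mulr_sumr ler_wpM2l//; apply: nneg_series_tail_le => // k.
exact: sqr_ge0.
Qed.

(** The image of the unit ball lies in a Hilbert cube. *)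
Lemma dominated_compact_operator (T : {linear ell2 R -> ell2 R}) w :
  cvgn (series (fun n => w n ^+ 2)) ->
  (forall f, ell2_norm f <= 1 -> forall n, normc (T f n) <= w n) ->
  compact_operator T.
Proof.
move=> cw Tw; apply: precompact_subset (compact_precompact _ (compact_hilbert_cube cw)).
  by move=> _ [f /= f1 <-] n; apply: Tw; move: f1; rewrite ell2_normE lecR.
exact: norm_hausdorff.
Qed.


End CompactOperators.

(** * Schur's test *)

Section SchurTest.
Variable R : realType.
Implicit Types (f g h : ell2 R) (a : nat -> nat -> R).

Definition real_matrix a : nat -> nat -> R[i] := fun n m => (a n m)%:C.

(** Schur's test on finite sections: Cauchy-Schwarz with the weights
[a n m * p m] and [a n m / p m]. *)
Lemma schur_sections a (p x : nat -> R) (C : R) N M :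
  (forall n m, 0 <= a n m) -> (forall n m, a n m = a m n) ->
  (forall n, 0 < p n) ->
  (forall n K, \sum_(m < K) a n m * p m <= C * p n) ->
  \sum_(n < N) (\sum_(m < M) a n m * x m) ^+ 2 <= C ^+ 2 * \sum_(m < M) x m ^+ 2.
Proof.
move=> a0 sa p0 ap.
have C0 : 0 <= C.
  by rewrite -(pmulr_lge0 _ (p0 0%N)); have := ap 0%N 0%N; rewrite big_ord0.
apply: (@le_trans _ _ (\sum_(n < N) C * p n * \sum_(m < M) a n m * (x m ^+ 2 / p m))).
  apply: ler_sum => n _.
  have -> : \sum_(m < M) a n m * x m =
      \sum_(m < M) Num.sqrt (a n m * p m) * (Num.sqrt (a n m / p m) * x m).
    apply: eq_bigr => m _; rewrite mulrA -sqrtrM ?mulr_ge0 ?(ltW (p0 _))//.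
    rewrite mulrACA mulfV ?gt_eqF// mulr1 -expr2 sqrtr_sqr ger0_norm//.
  apply: le_trans (cauchy_schwarz_sum (fun m => Num.sqrt (a n m * p m))
    (fun m => Num.sqrt (a n m / p m) * x m) M) _.
  apply: ler_pM.
  - by apply: sumr_ge0 => m _; exact: sqr_ge0.
  - by apply: sumr_ge0 => m _; exact: sqr_ge0.
  - under eq_bigr do rewrite sqr_sqrtr ?mulr_ge0 ?(ltW (p0 _))//.
    exact: ap.
  - apply: ler_sum => m _; rewrite exprMn sqr_sqrtr ?divr_ge0 ?(ltW (p0 _))//.
    by rewrite -mulrA [_^-1 * _]mulrC.
under eq_bigr do rewrite mulr_sumr.
rewrite exchange_big mulr_sumr; apply: ler_sum => m _ /=.
apply: (@le_trans _ _ (C * (x m ^+ 2 / p m) * \sum_(n < N) a m n * p n)).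
  by rewrite mulr_sumr; apply: ler_sum => n _; rewrite (sa n m) le_eqVlt; apply/orP; left; apply/eqP; ring.
apply: (@le_trans _ _ (C * (x m ^+ 2 / p m) * (C * p m))).
  by rewrite ler_wpM2l// mulr_ge0// divr_ge0 ?sqr_ge0// ltW.
by rewrite le_eqVlt; apply/orP; left; apply/eqP; field; rewrite gt_eqF.
Qed.

(** The bound with [x] replaced by moduli makes every row series absolutely
convergent; it then passes to the limit, first in the columns, then in the rows. *)
Lemma bounded_sections_operator a (C : R) : 0 <= C -> (forall n m, 0 <= a n m) ->
  (forall (x : nat -> R) N M, \sum_(n < N) (\sum_(m < M) a n m * x m) ^+ 2 <=
     C ^+ 2 * \sum_(m < M) x m ^+ 2) ->
  exists2 T : {linear ell2 R -> ell2 R},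
    forall f, ell2_norm (T f) <= C * ell2_norm f & matrix_of T (real_matrix a).
Proof.
move=> C0 a0 aC.
pose S (f : nat -> R[i]) n := series (fun m => (a n m)%:C * f m : R[i]^o).
pose V (f : nat -> R[i]) n := series (fun m => a n m * normc (f m)).
have term0 (f : nat -> R[i]) n m : 0 <= a n m * normc (f m).
  by rewrite mulr_ge0 ?normc_ge0.
have VC f N M : \sum_(n < N) V f n M ^+ 2 <= (C * ell2_norm f) ^+ 2.
  rewrite exprMn; apply: (@le_trans _ _ (C ^+ 2 * \sum_(m < M) normc (f m) ^+ 2)).
    apply: le_trans (aC (fun m => normc (f m)) N M); apply: ler_sum => n _.
    by rewrite /V /series/= big_mkord.
  by rewrite ler_wpM2l ?sqr_ge0// sum_le_ell2_norm.
have V0 (f : nat -> R[i]) n M : 0 <= V f n M by apply: sumr_ge0.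
have cV f n : cvgn (V f n).
  apply: (@nneg_series_cvg _ _ (C * ell2_norm f)) => // M.
  have -> : \sum_(k < M) a n k * normc (f k) = V f n M by rewrite /V /series/= big_mkord.
  rewrite -ler_sqr ?nnegrE ?mulr_ge0 ?ell2_norm_ge0//.
  apply: le_trans (VC f n.+1 M); rewrite big_ord_recr/= lerDr.
  by apply: sumr_ge0 => k _; exact: sqr_ge0.
have nE (f : nat -> R[i]) n m : normc ((a n m)%:C * f m) = a n m * normc (f m).
  by rewrite ComplexField.Normc.normcM normc_real ger0_norm.
have cS f n : cvgn (S f n).
  apply: abs_summable_cvg.
  by rewrite [X in series X](_ : _ = fun m => a n m * normc (f m)); [exact: cV|exact/funext].
pose T0 f : nat -> R[i] := fun n => limn (S f n).
have T0V f n : normc (T0 f n) <= limn (V f n).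
  apply: (@normc_lim_le _ (S f n)); first exact: cS.
  move=> M; apply: le_trans (normc_sum _ _ _) _.
  rewrite big_mkord; under eq_bigr do rewrite nE.
  by apply: nneg_series_le_lim; [exact: term0|exact: cV].
have T0C f N : \sum_(n < N) normc (T0 f n) ^+ 2 <= (C * ell2_norm f) ^+ 2.
  apply: (@le_trans _ _ (\sum_(n < N) limn (V f n) ^+ 2)).
    apply: ler_sum => n _; rewrite ler_sqr ?nnegrE ?normc_ge0//.
    exact: le_trans (normc_ge0 _) (T0V f n).
  have h : (\sum_(n < N) V f n M ^+ 2) @[M --> \oo] --> \sum_(n < N) limn (V f n) ^+ 2.
    by apply: (@cvg_sumr _ _ _ N (fun n M => V f n M ^+ 2) (fun n => limn (V f n) ^+ 2)) => n;
      apply: cvgM; exact: cV.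
  rewrite -(cvg_lim _ h)//; apply: limr_le; first by apply/cvg_ex; eexists; exact: h.
  by apply: nearW => M; exact: VC.
have T0l f : T0 f \in @ell2_pred R.
  apply/ell2P; have [] // := @sqsum_bounded _ (T0 f) ((C * ell2_norm f) ^+ 2).
  by move=> N; rewrite sqsumE.
pose T f : ell2 R := Ell2 (T0l f).
have linT : linear T.
  move=> c f g; apply: val_inj; apply/funext => n.
  rewrite -[LHS]/(T0 (c *: f + g) n) -[RHS]/(c * T0 f n + T0 g n).
  apply: (@complex_cvg_unique _ (S (c *: f + g) n)); first exact: cS.
  apply: cvg_eq (cvgD (cvgZr (k := c) (@cS f n)) (@cS g n)) => M.
  rewrite /= /S /series/= [X in X + _ = _]mulr_sumr -[LHS]big_split/=.
  by apply: eq_bigr => m _; rewrite mulrDr mulrCA.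
pose L : {linear ell2 R -> ell2 R} :=
  HB.pack T (GRing.isLinear.Build _ _ _ _ T linT).
exists L.
  move=> f; apply: ell2_norm_le => [|N]; first by rewrite mulr_ge0 ?ell2_norm_ge0.
  exact: T0C.
move=> n m; apply: (@complex_cvg_unique _ (S (ell2_basis R m) n)); first exact: cS.
apply: (@cvg_trans _ (cst (real_matrix a n m : R[i]^o) @ \oo)); last exact: cvg_cst.
apply: near_eq_cvg; exists m.+1 => // k /= mk.
rewrite /S /series/= big_mkord (bigD1 (Ordinal mk))//= eqxx mulr1 big1 ?addr0//.
by move=> i /negPf ni; rewrite -[_ == m]/(i == Ordinal mk) ni mulr0.
Qed.

Lemma schur_operator a (p : nat -> R) (C : R) :
  (forall n m, 0 <= a n m) -> (forall n m, a n m = a m n) ->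
  (forall n, 0 < p n) ->
  (forall n K, \sum_(m < K) a n m * p m <= C * p n) ->
  exists2 T : {linear ell2 R -> ell2 R},
    bounded_operator T & matrix_of T (real_matrix a).
Proof.
move=> a0 sa p0 ap.
have C0 : 0 <= C.
  by rewrite -(pmulr_lge0 _ (p0 0%N)); have := ap 0%N 0%N; rewrite big_ord0.
have [T TC TA] := bounded_sections_operator C0 a0
  (fun x N M => schur_sections x N M a0 sa p0 ap).
by exists T => //; exact: bounded_operator_intro TC.
Qed.

(** Schur's test with the weight [w] itself gives boundedness, and by
Cauchy-Schwarz the image of the unit ball has coordinates at most
[sqrt (sum w^2) * w n]. *)
Lemma rank_one_dominated_operator a (w : nat -> R) :
  (forall n m, 0 <= a n m) -> (forall n m, a n m = a m n) ->
  (forall n, 0 < w n) -> cvgn (series (fun n => w n ^+ 2)) ->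
  (forall n m, a n m <= w n * w m) ->
  exists T : {linear ell2 R -> ell2 R},
    [/\ bounded_operator T, matrix_of T (real_matrix a) & compact_operator T].
Proof.
move=> a0 sa w0 cw aw; set W := limn (series (fun n => w n ^+ 2)) in cw *.
have sW K : \sum_(m < K) w m ^+ 2 <= W.
  by apply: nneg_series_le_lim => // k; exact: sqr_ge0.
have aC n K : \sum_(m < K) a n m * w m <= W * w n.
  apply: (@le_trans _ _ (w n * \sum_(m < K) w m ^+ 2)).
    by rewrite mulr_sumr; apply: ler_sum => m _; rewrite expr2 mulrA ler_wpM2r// ltW.
  by rewrite mulrC ler_wpM2r// ltW.
have [T bT TA] := schur_operator a0 sa w0 aC.
exists T; split => //.
have cw' : cvgn (series (fun n => (Num.sqrt W * w n) ^+ 2)).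
  have -> : (fun n => (Num.sqrt W * w n) ^+ 2) = (Num.sqrt W ^+ 2) *: (fun n => w n ^+ 2).
    by apply/funext => n; rewrite exprMn.
  exact: is_cvg_seriesZ.
apply: (dominated_compact_operator cw') => f f1 n.
have [M M0 hM] := bounded_operatorP bT.
have TM N : normc (T (truncation N f) n) <= Num.sqrt W * w n.
  rewrite (truncation_image _ _ _ TA); apply: le_trans (normc_sum _ _ _) _.
  apply: (@le_trans _ _ (w n * \sum_(m < N) w m * normc (f m))).
    rewrite mulr_sumr; apply: ler_sum => m _.
    rewrite ComplexField.Normc.normcM normc_real ger0_norm// mulrA.
    by rewrite ler_wpM2r ?normc_ge0.
  rewrite mulrC ler_wpM2r ?(ltW (w0 n))//.
  apply: le_trans (ler_norm _) _; rewrite -sqrtr_sqr ler_wsqrtr//.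
  apply: le_trans (cauchy_schwarz_sum w (fun m => normc (f m)) N) _.
  rewrite -[leRHS]mulr1; apply: ler_pM => //.
  - by apply: sumr_ge0 => k _; exact: sqr_ge0.
  - by apply: sumr_ge0 => k _; exact: sqr_ge0.
  - apply: le_trans (sum_le_ell2_norm _ _) _.
    by rewrite expr_le1// ell2_norm_ge0.
apply: (@normc_lim_le _ (fun N => T (truncation N f) n)) => //.
apply/cvg_normcP.
have h : (fun N => M * ell2_norm (f - truncation N f)%R) @ \oo --> (0 : R).
  by rewrite -[X in _ --> X](mulr0 M); apply: cvgM; [exact: cvg_cst|exact: truncation_cvg].
apply: squeeze_cvgr (cvg_cst 0) h; apply: nearW => N; rewrite normc_ge0/=.
rewrite -normc_opp opprB.
have e : T (f - truncation N f) = (T f - T (truncation N f))%R by rewrite linearB.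
have := hM (f - truncation N f)%R; rewrite e; apply: le_trans.
exact: (@coord_le_ell2_norm R (T f - T (truncation N f))%R n).
Qed.

End SchurTest.

(** * Spectral theory *)

Section SpectralTheory.
Variable R : realType.
Implicit Types (f g h v phi : ell2 R) (T P : {linear ell2 R -> ell2 R}).

(** Compactness gives a cluster point of the sequence of images; stating it with
indices spares the extraction of a subsequence. *)
Lemma compact_operator_cluster T (u : nat -> ell2 R) : compact_operator T ->
  (forall k, ell2_norm (u k) <= 1) ->
  exists h, forall (e : R) K, 0 < e ->
    exists2 k, (K <= k)%N & ell2_norm (T (u k) - h)%R < e.
Proof.
rewrite /compact_operator precompactE => cT u1.
have [h [_ ch]] : closure [set T f | f in [set f : ell2 R | `|f| <= 1]] `&`
    cluster ((fun k => T (u k)) @ \oo) !=set0.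
  apply: cT; exists 0%N => // k _ /=; apply: subset_closure.
  by exists (u k) => //=; rewrite ell2_normE lecR.
exists h => e K e0.
have e0' : 0 < (e%:C : R[i]) by rewrite ltcR.
have FK : ((fun k => T (u k)) @ \oo) [set T (u k) | k in [set k | (K <= k)%N]].
  by exists K => // k /= Kk; exists k.
have [_ [/= [k /= Kk <-]]] := ch _ _ FK (nbhsx_ballx h e%:C e0').
rewrite -ball_normE/= ell2_normE ltcR => hk; exists k => //.
suff -> : ell2_norm (T (u k) - h)%R = ell2_norm (h - T (u k))%R by [].
by rewrite -[LHS]ell2_normN opprB.
Qed.

Lemma dotp_quadratic_real T f : adjoint_of T T ->
  dotp (T f) f = (Re (dotp (T f) f))%:C.
Proof.
move=> sT; rewrite RRe_real//; apply/CrealP.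
by rewrite dotp_conj sT.
Qed.

Section TopEigenvector.
Variables (T : {linear ell2 R -> ell2 R}) (M : R).
Hypotheses (M0 : 0 <= M) (TM : forall f, ell2_norm (T f) <= M * ell2_norm f).
Hypotheses (sT : adjoint_of T T) (cT : compact_operator T).
Hypothesis Tpos : exists f, 0 < Re (dotp (T f) f).

Let Q f := Re (dotp (T f) f).

Let QE f : dotp (T f) f = (Q f)%:C. Proof. exact: dotp_quadratic_real. Qed.

Let Q_le f : Q f <= ell2_norm (T f) * ell2_norm f.
Proof.
apply: le_trans (cauchy_schwarz (T f) f).
exact: le_trans (ler_norm _) (Re_le_normc _).
Qed.

Let QZ (x : R) f : Q (x%:C *: f) = x ^+ 2 * Q f.
Proof.
by apply: complexI; rewrite -QE linearZ dotpZl dotpZr conj_real QE expr2 -mulrA !rmorphM.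
Qed.

Let Q0 : Q 0 = 0.
Proof. by have := QZ 0 0; rewrite scale0r expr0n mul0r. Qed.

Let ball_values := [set Q f | f in [set f : ell2 R | ell2_norm f <= 1]].

Let lam := sup ball_values.

Let ball_values_sup : has_sup ball_values.
Proof.
split.
  by exists (Q 0), 0 => //=; rewrite ell2_norm0.
exists M => _ [f /= f1 <-]; apply: le_trans (Q_le f) _.
apply: (@le_trans _ _ (M * 1 * 1)); last by rewrite !mulr1.
apply: ler_pM => //; rewrite ?ell2_norm_ge0//.
by apply: le_trans (TM f) _; rewrite ler_wpM2l.
Qed.

Let Q_le_lam f : Q f <= lam * ell2_norm f ^+ 2.
Proof.
have [/ell2_norm_eq0 ->|f0] := eqVneq (ell2_norm f) 0.
  by rewrite Q0 ell2_norm0 expr0n mulr0.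
have n0 : 0 < ell2_norm f by rewrite lt_neqAle eq_sym f0 ell2_norm_ge0.
have : Q ((ell2_norm f)^-1%:C *: f) <= lam.
  apply: sup_upper_bound => //; exists ((ell2_norm f)^-1%:C *: f) => //=.
  by rewrite ell2_normZ normc_real ger0_norm ?invr_ge0 ?ell2_norm_ge0// mulVf.
by rewrite QZ exprVn mulrC ler_pdivrMr ?exprn_gt0.
Qed.

Let lam_gt0 : 0 < lam.
Proof.
have [f Qf] := Tpos; have := lt_le_trans Qf (Q_le_lam f).
have [/ell2_norm_eq0 f0|f0 h] := eqVneq (ell2_norm f) 0.
  by move: Qf; rewrite f0 -/(Q 0) Q0 ltxx.
by rewrite -(pmulr_lgt0 _ (_ : 0 < ell2_norm f ^+ 2))// exprn_gt0// lt_neqAle eq_sym f0 ell2_norm_ge0.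
Qed.

(** The form of [lam - T] is nonnegative; its value at [f - s (lam - T) f] with
s = 1 / (lam + M) gives this estimate. *)
Let defect_le f :
  ell2_norm (lam%:C *: f - T f)%R ^+ 2 <= (lam + M) * (lam * ell2_norm f ^+ 2 - Q f).
Proof.
set h := (lam%:C *: f - T f)%R.
have hE : h = (lam%:C *: f - T f)%R by [].
clearbody h; set L := lam + M; set n2 := ell2_norm h ^+ 2.
have L0 : 0 < L by rewrite ltr_wpDr.
pose s := L^-1.
pose E g := lam * ell2_norm g ^+ 2 - Q g.
have EE g : (E g)%:C = lam%:C * dotp g g - dotp (T g) g.
  by rewrite QE dotp_self -rmorphM -rmorphB.
have hh : dotp h h = lam%:C * dotp f h - dotp (T f) h.
  by rewrite {1}hE dotpBl dotpZl.
have hh' : dotp h h = lam%:C * dotp h f - dotp (T h) f.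
  by rewrite {2}hE dotpBr dotpZr conj_real sT.
have e : E (f - s%:C *: h)%R = E f - 2 * s * n2 + s ^+ 2 * E h.
  apply: complexI.
  have -> : (E f - 2 * s * n2 + s ^+ 2 * E h)%:C =
      (E f)%:C - 2%:R * s%:C * n2%:C + s%:C * s%:C * (E h)%:C.
    by rewrite rmorphD rmorphB expr2 !rmorphM rmorph_nat.
  rewrite !EE -[n2%:C]dotp_self [T _]linearB/= [T (_ *: _)]linearZ/=.
  rewrite !(dotpBl, dotpBr, dotpZl, dotpZr) conj_real.
  have -> : 2%:R * s%:C * dotp h h = s%:C * (lam%:C * dotp f h - dotp (T f) h) +
     s%:C * (lam%:C * dotp h f - dotp (T h) f) by rewrite -hh -hh'; ring.
  ring.
have E0 : 0 <= E (f - s%:C *: h)%R by rewrite subr_ge0.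
have Eh : E h <= L * n2.
  rewrite /E /L mulrDl lerD2l.
  apply: (@le_trans _ _ (ell2_norm (T h) * ell2_norm h)); last first.
    by rewrite /n2 expr2 mulrA ler_wpM2r ?ell2_norm_ge0.
  apply: le_trans (cauchy_schwarz (T h) h).
  by apply: le_trans (Re_le_normc _); rewrite -normrN; exact: ler_norm.
have : 0 <= E f - 2 * s * n2 + s ^+ 2 * (L * n2).
  apply: le_trans E0 _; rewrite e lerD2l ler_wpM2l ?sqr_ge0//.
have -> : E f - 2 * s * n2 + s ^+ 2 * (L * n2) = E f - n2 / L.
  by rewrite /s; field; rewrite gt_eqF.
by rewrite subr_ge0 ler_pdivrMr// mulrC.
Qed.

(** A maximizing sequence of the form on the unit ball consists of approximate
eigenvectors, by [defect_le], and compactness makes its images accumulate at a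
true one. *)
Lemma top_eigenvector : exists (l : R) phi,
  [/\ 0 < l, ell2_norm phi = 1 & T phi = l%:C *: phi].
Proof.
have hu k : exists f, ell2_norm f <= 1 /\ lam - k.+1%:R^-1 < Q f.
  have [|_ [f f1 <-] hf] := @sup_adherent _ ball_values k.+1%:R^-1 _ ball_values_sup.
    by rewrite invr_gt0.
  by exists f.
have [u uP] := choice hu.
have u1 k : ell2_norm (u k) <= 1 by have [] := uP k.
have uQ k : lam - Q (u k) < k.+1%:R^-1 by have [_] := uP k; rewrite ltrBlDr -ltrBlDl.
have [h hP] := compact_operator_cluster cT u1.
have L0 : 0 < lam + M by rewrite ltr_wpDr.
have small (e : R) : 0 < e -> exists K, forall k, (K <= k)%N -> k.+1%:R^-1 < e.
  move=> e0; have /cvgrPdist_lt/(_ _ e0)[K _ hK] := @cvg_harmonic R.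
  exists K => k Kk; have := hK k Kk; rewrite /= sub0r normrN ger0_norm// invr_ge0.
have Th : T h = lam%:C *: h.
  apply/eqP; rewrite -subr_eq0; apply/eqP/ell2_norm_eq0/eqP.
  rewrite eq_le ell2_norm_ge0 andbT; apply/ler_addgt0Pr => e e0; rewrite add0r.
  have c0 : 0 < M + M + lam + 1 by rewrite ltr_wpDl// !addr_ge0// ltW.
  pose d := e / (M + M + lam + 1); have d0 : 0 < d by rewrite divr_gt0.
  have d2 : 0 < d ^+ 2 / (lam + M) by rewrite divr_gt0 ?exprn_gt0.
  have [K hK] := small _ d2; have [k Kk hk] := hP d K d0.
  have df : ell2_norm (lam%:C *: u k - T (u k))%R <= d.
    rewrite -ler_sqr ?nnegrE ?ell2_norm_ge0 ?(ltW d0)//.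
    apply: le_trans (defect_le _) _.
    rewrite mulrC -ler_pdivlMr//; apply: le_trans (ltW (hK k Kk)).
    apply: le_trans (ltW (uQ k)); rewrite lerD2r -[leRHS]mulr1 ler_wpM2l ?(ltW lam_gt0)//.
    by rewrite expr_le1// ell2_norm_ge0.
  have -> : (T h - lam%:C *: h)%R = (lam%:C *: (T (u k) - h) - T (T (u k) - h) -
      T (lam%:C *: u k - T (u k)))%R.
    have zE (V : zmodType) (x y z w : V) : x - y - (z - w) - (x - z) = w - y.
      by rewrite !opprB -addrA [w - z + _]addrA subrK addrC addrA subrK.
    by rewrite scalerBr [T (_ - h)]linearB [T (_ - T _)]linearB/= [T (_ *: _)]linearZ/= zE.
  apply: le_trans (ell2_normB _ _) _.
  apply: (@le_trans _ _ (lam * d + M * d + M * d)).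
    apply: lerD.
      apply: le_trans (ell2_normB _ _) _; apply: lerD.
        by rewrite ell2_normZ normc_real gtr0_norm// ler_wpM2l ?ltW.
      by apply: le_trans (TM _) _; rewrite ler_wpM2l// ltW.
    by apply: le_trans (TM _) _; rewrite ler_wpM2l.
  have -> : lam * d + M * d + M * d = (M + M + lam) * d by ring.
  rewrite /d mulrCA ler_piMr ?(ltW e0)// ler_pdivrMr// mul1r lerDl//.
have h0 : ell2_norm h != 0.
  apply/eqP => h0; have l2 : 0 < lam / 2 by rewrite divr_gt0.
  have [K hK] := small _ l2; have [k Kk hk] := hP _ K l2.
  have Tu : ell2_norm (T (u k)) < lam / 2.
    by move: hk; rewrite (ell2_norm_eq0 h0) subr0.
  have Qu : Q (u k) <= ell2_norm (T (u k)).
    apply: le_trans (Q_le _) _; rewrite -[leRHS]mulr1 ler_wpM2l ?ell2_norm_ge0//.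
  have := lt_trans (uQ k) (hK k Kk); have := splitr lam; lra.
exists lam, ((ell2_norm h)^-1%:C *: h); split => //.
  by rewrite ell2_normZ normc_real ger0_norm ?invr_ge0 ?ell2_norm_ge0// mulVf.
by rewrite linearZ/= Th !scalerA mulrC.
Qed.

End TopEigenvector.

Section AbsoluteValue.
Variables (T : {linear ell2 R -> ell2 R}) (l : R) (phi v : ell2 R).
Hypotheses (bT : bounded_operator T) (sT : adjoint_of T T).
Hypotheses (l0 : 0 < l) (phi1 : ell2_norm phi = 1) (Tphi : T phi = l%:C *: phi).
Hypothesis Tneg : forall g, dotp g v = 0 -> dotp (T g) g <= 0.

Let dotp_phi : dotp phi phi = 1.
Proof. by rewrite dotp_self phi1 expr1n. Qed.

Let form_split g (t : R[i]) : dotp g phi = 0 ->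
  dotp (T (g + t *: phi)%R) (g + t *: phi)%R = dotp (T g) g + (l * normc t ^+ 2)%:C.
Proof.
move=> gphi; have phig : dotp phi g = 0 by rewrite -dotp_conj gphi conjC0.
rewrite [T (_ + _)]linearD [T (_ *: _)]linearZ/= Tphi.
rewrite !(dotpDl, dotpDr, dotpZl, dotpZr) phig dotp_phi (sT g phi) Tphi dotpZr gphi.
by rewrite rmorphM/= -mul_conj; ring.
Qed.

(** Otherwise the form of [T] would be positive definite on the span of [phi] and
[g], which meets the orthogonal complement of [v]. *)
Let neg_on_complement g : dotp g phi = 0 -> dotp (T g) g <= 0.
Proof.
move=> gphi; have [a0|a0] := eqVneq (dotp phi v) 0.
  by have := Tneg a0; rewrite Tphi dotpZl dotp_phi mulr1 lecR leNgt l0.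
pose t := - (dotp g v / dotp phi v).
have : dotp (g + t *: phi)%R v = 0.
  by rewrite dotpDl dotpZl /t mulNr divfK// subrr.
move/Tneg; rewrite form_split//; apply: le_trans.
by rewrite lerDl lecR mulr_ge0 ?sqr_ge0// ltW.
Qed.

(** [T] with its sign kept on [phi] and reversed on the orthogonal complement. *)
Definition abs_fun f : ell2 R := ((2 * l)%:C * dotp f phi) *: phi - T f.

Lemma abs_fun_linear : linear abs_fun.
Proof.
move=> c f g; rewrite /abs_fun dotpDl dotpZl linearP/= scalerBr scalerA.
rewrite mulrDr scalerDl mulrCA; rewrite opprD addrACA; congr (_ + _).
Qed.

(** The form of [T] is nonpositive on the orthogonal complement of [phi], so [|T|]
is [- T] there and [l] on the line of [phi]. *)
Lemma absolute_value_exists : exists P : {linear ell2 R -> ell2 R},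
  absolute_value_of T P /\
  forall n, dotp (P (ell2_basis R n)) (ell2_basis R n) =
    (2 * l * normc (phi n) ^+ 2)%:C - dotp (T (ell2_basis R n)) (ell2_basis R n).
Proof.
pose P : {linear ell2 R -> ell2 R} :=
  HB.pack abs_fun (GRing.isLinear.Build _ _ _ _ abs_fun abs_fun_linear).
have PE f : P f = abs_fun f by [].
exists P; split.
  split.
  - have [M M0 TM] := bounded_operatorP bT.
    apply: (@bounded_operator_intro _ _ (2 * l + M)) => f; rewrite PE.
    apply: le_trans (ell2_normB _ _) _; rewrite [leRHS]mulrDl; apply: lerD; last exact: TM.
    rewrite ell2_normZ phi1 mulr1 ComplexField.Normc.normcM normc_real.
    rewrite ger0_norm ?mulr_ge0 ?(ltW l0)//; apply: ler_wpM2l.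
      by rewrite mulr_ge0// ltW.
    by apply: le_trans (cauchy_schwarz _ _) _; rewrite phi1 mulr1.
  - move=> f; set c := dotp f phi; pose g := (f - c *: phi)%R.
    have gphi : dotp g phi = 0.
      by rewrite dotpBl dotpZl dotp_phi mulr1 subrr.
    have fE : f = (g + c *: phi)%R by rewrite /g subrK.
    have -> : dotp (P f) f = (l * normc c ^+ 2)%:C - dotp (T g) g.
      rewrite PE /abs_fun dotpBl dotpZl -/c -(dotp_conj f phi) -/c -mulrA mul_conj.
      rewrite {1 2}fE form_split// !rmorphM/= (rmorph_nat _ 2); ring.
    rewrite subr_ge0; apply: le_trans (neg_on_complement gphi) _.
    by rewrite lecR mulr_ge0 ?sqr_ge0// ltW.
  - exists T => // f; rewrite !PE /abs_fun.
    rewrite dotpBl dotpZl dotp_phi mulr1 (sT f phi) Tphi dotpZr conj_real.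
    rewrite [T (_ - _)]linearB [T (_ *: phi)]linearZ/= Tphi scalerA opprB addrCA -scalerBl.
    rewrite [X in _ + X *: _](_ : _ = 0) ?scale0r ?addr0//.
    by rewrite !rmorphM/= (rmorph_nat _ 2); ring.
move=> n; rewrite PE /abs_fun dotpBl dotpZl -(dotp_conj _ phi) -mulrA mul_conj.
by rewrite -(dotp_conj phi) dotp_basisr normc_conj -rmorphM.
Qed.

End AbsoluteValue.

(** The two conditions on the form leave exactly one positive eigenvalue, so
[absolute_value_exists] applies; the diagonal entries of [|T|] are
[2 * l * |phi n|^2 - d n]. *)
Lemma trace_class_one_positive T v (d : nat -> R) :
  bounded_operator T -> adjoint_of T T -> compact_operator T ->
  (exists f, 0 < Re (dotp (T f) f)) ->
  (forall g, dotp g v = 0 -> dotp (T g) g <= 0) ->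
  (forall n, dotp (T (ell2_basis R n)) (ell2_basis R n) = (d n)%:C) ->
  (forall n, 0 <= d n) -> cvgn (series d) -> trace_class_operator T.
Proof.
move=> bT sT cT Tpos Tneg Td d0 cd.
have [M M0 TM] := bounded_operatorP bT.
have [l [phi [l0 phi1 Tphi]]] := top_eigenvector M0 TM sT cT Tpos.
have [P [PT Pn]] := absolute_value_exists bT sT l0 phi1 Tphi Tneg.
exists P => //; apply: abs_summable_cvg.
have cb : cvgn (series ((2 * l) *: (fun n => normc (phi n) ^+ 2) + d)).
  by apply: is_cvg_seriesD => //; apply: is_cvg_seriesZ; exact: (@sqsum_cvg _ phi).
have p0 n : 0 <= 2 * l * normc (phi n) ^+ 2 by rewrite mulr_ge0 ?sqr_ge0// mulr_ge0// ltW.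
apply: series_le_cvg cb => n.
- exact: normc_ge0.
- by rewrite addr_ge0//; exact: p0.
rewrite Pn Td; apply: le_trans (normcD _ _) _.
by rewrite normc_opp !normc_real !ger0_norm.
Qed.

Lemma trace_class_positive T (d : nat -> R) :
  bounded_operator T -> adjoint_of T T -> positive_operator T ->
  (forall n, dotp (T (ell2_basis R n)) (ell2_basis R n) = (d n)%:C) ->
  (forall n, 0 <= d n) -> cvgn (series d) -> trace_class_operator T.
Proof.
move=> bT sT pT Td d0 cd; exists T; first by split => //; exists T.
apply: abs_summable_cvg.
apply: series_le_cvg cd => n //; first exact: normc_ge0.
by rewrite Td normc_real ger0_norm.
Qed.

End SpectralTheory.

(** * Power sums *)

Section PowerSums.
Variable R : realType.
Implicit Types (x y a s : R) (n m N : nat).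

(** A power of [n.+1], the positive integer that the index [n] stands for. *)
Definition pw x n : R := n.+1%:R `^ x.

Lemma pw_gt0 x n : 0 < pw x n. Proof. by rewrite powR_gt0. Qed.
Lemma pw_ge0 x n : 0 <= pw x n. Proof. exact: powR_ge0. Qed.
Lemma pw_at0 x : pw x 0 = 1. Proof. by rewrite /pw powR1. Qed.
Lemma pw0 n : pw 0 n = 1. Proof. by rewrite /pw powRr0. Qed.
Lemma pw1 n : pw 1 n = n.+1%:R. Proof. by rewrite /pw powRr1. Qed.

Lemma pwD x y n : pw (x + y) n = pw x n * pw y n.
Proof. by rewrite /pw powRD// pnatr_eq0 implybT. Qed.

Lemma pwN x n : pw (- x) n = (pw x n)^-1. Proof. exact: powRN. Qed.

Lemma pw_half_sqr x n : pw (x / 2) n ^+ 2 = pw x n.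
Proof. by rewrite expr2 -pwD -splitr. Qed.

Lemma pw_mono x n m : 0 <= x -> (n <= m)%N -> pw x n <= pw x m.
Proof. by move=> x0 nm; apply: ge0_ler_powR; rewrite ?nnegrE// ler_nat. Qed.

Lemma pw_anti x n m : 0 <= x -> (n <= m)%N -> pw (- x) m <= pw (- x) n.
Proof. by move=> x0 nm; rewrite !pwN lef_pV2 ?posrE ?pw_gt0//; exact: pw_mono. Qed.

Lemma pw_le_exponent x y n : x <= y -> pw x n <= pw y n.
Proof. by move=> xy; apply: ler_powR => //; rewrite ler1n. Qed.

(** Bernoulli-type growth of [k^a], from [1 - u <= exp (- u)]. *)
Lemma pw_growth a n : 0 < a -> pw a n * (1 + a / n.+2%:R) <= pw a n.+1.
Proof.
move=> a0; set m : R := n.+2%:R; have m0 : 0 < m by rewrite ltr0n.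
apply: (@le_trans _ _ (expR (m^-1 * a) * pw a n)).
  by rewrite mulrC ler_wpM2r ?pw_ge0// [m^-1 * a]mulrC expR_ge1Dx.
rewrite expRM -powRM; [|exact: expR_ge0|exact: ler0n]; apply: ge0_ler_powR; first exact: ltW.
- by rewrite nnegrE mulr_ge0 ?expR_ge0.
- by rewrite nnegrE.
rewrite -ler_pdivlMl ?expR_gt0// -expRN mulrC.
apply: (@le_trans _ _ (m * (1 + - m^-1))).
  by rewrite mulrDr mulr1 mulrN mulfV ?gt_eqF// /m -[n.+2]addn1 natrD addrK.
by rewrite ler_wpM2l ?(ltW m0)// expR_ge1Dx.
Qed.

(** By [pw_growth], [pw (a - 1)] is at most a multiple of the increments of [pw a],
so the sum telescopes. *)
Lemma sum_pw_le a n : 0 < a -> \sum_(k < n.+1) pw (a - 1) k <= (1 + a) / a * pw a n.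
Proof.
move=> a0; elim: n => [|n ih].
  rewrite big_ord_recl big_ord0 !pw_at0 addr0 mulr1 ler_pdivlMr// mul1r.
  by rewrite lerDr.
rewrite big_ord_recr/=; apply: le_trans (lerD ih (lexx _)) _.
set m : R := n.+2%:R; have m1 : 1 <= m by rewrite ler1n.
have m0 : 0 < m by apply: lt_le_trans m1.
have e : pw (a - 1) n.+1 = pw a n.+1 / m by rewrite pwD pwN pw1.
have y0 : 0 < 1 + a / m by rewrite ltr_wpDr// divr_ge0// ltW.
have g : pw a n <= pw a n.+1 / (1 + a / m) by rewrite ler_pdivlMr//; exact: pw_growth.
apply: (@le_trans _ _ ((1 + a) / a * (pw a n.+1 / (1 + a / m)) + pw a n.+1 / m)).
  by rewrite e lerD2r ler_wpM2l// divr_ge0 ?addr_ge0 ?ltW.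
rewrite -lerBrDl -subr_ge0; clearbody m.
have -> : (1 + a) / a * pw a n.+1 - (1 + a) / a * (pw a n.+1 / (1 + a / m)) -
    pw a n.+1 / m = pw a n.+1 / (m + a) * (a * (m - 1) / m).
  by field; rewrite !gt_eqF ?addr_gt0.
by rewrite !mulr_ge0 ?pw_ge0 ?invr_ge0 ?subr_ge0// ?addr_ge0// ?ltW.
Qed.

(** The same telescoping with the decrements of [pw (- a)]. *)
Lemma sum_pw_tail_le a n N : 0 < a ->
  \sum_(n.+1 <= k < N) pw (- a - 1) k <= pw (- a) n / a.
Proof.
move=> a0; have step k : pw (- a - 1) k.+1 <= (pw (- a) k - pw (- a) k.+1) / a.
  have g := pw_growth k a0.
  set m : R := k.+2%:R in g *; have m0 : 0 < m by rewrite ltr0n.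
  have -> : pw (- a - 1) k.+1 = (pw a k.+1)^-1 / m by rewrite pwD !pwN pw1.
  rewrite ler_pdivlMr// !pwN lerBrDr.
  have -> : (pw a k.+1)^-1 / m * a + (pw a k.+1)^-1 = (1 + a / m) / pw a k.+1.
    by clearbody m; field; rewrite !gt_eqF ?pw_gt0.
  by rewrite ler_pdivrMr ?pw_gt0// ler_pdivlMl ?pw_gt0.
suff h : forall j, \sum_(n.+1 <= k < n.+1 + j) pw (- a - 1) k <=
    (pw (- a) n - pw (- a) (n + j)) / a.
  have [Nn|nN] := leqP N n.+1; first by rewrite big_geq// divr_ge0 ?pw_ge0// ltW.
  rewrite -(subnKC (ltnW nN)); apply: le_trans (h _) _.
  by rewrite ler_wpM2r ?invr_ge0 ?(ltW a0)// lerBlDr lerDl pw_ge0.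
elim=> [|j ih]; first by rewrite addn0 big_geq// addn0 subrr mul0r.
have nj : (n.+1 <= n.+1 + j)%N by exact: leq_addr.
rewrite addnS big_nat_recr; last exact: nj.
apply: le_trans (lerD ih (step _)) _; rewrite -mulrDl addrA subrK addnS.
exact: lexx.
Qed.

Lemma pw_summable s : 1 < s -> cvgn (series (pw (- s))).
Proof.
move=> s1; have a0 : 0 < s - 1 by rewrite subr_gt0.
apply: (@nneg_series_cvg _ _ (1 + (s - 1)^-1)) => [n|N]; first exact: pw_ge0.
apply: (@le_trans _ _ (\sum_(0 <= k < N.+1) pw (- s) k)).
  by rewrite big_mkord big_ord_recr/= lerDl pw_ge0.
rewrite big_nat_recl// pw_at0 lerD2l.
have := @sum_pw_tail_le (s - 1) 0 N.+1 a0; rewrite pw_at0 mul1r.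
have -> : - (s - 1) - 1 = - s by ring.
by rewrite big_add1.
Qed.

Lemma pw_summable_gt1 s : cvgn (series (pw (- s))) -> 1 < s.
Proof.
move=> cs; rewrite ltNge; apply/negP => s1; apply: (@dvg_harmonic R).
apply: series_le_cvg cs => n; [exact: harmonic_ge0|exact: pw_ge0|].
by rewrite -[leLHS]/(n.+1%:R^-1) -pw1 -pwN; apply: pw_le_exponent; rewrite lerN2.
Qed.

Lemma pw_half_square_summable s : 1 < s ->
  cvgn (series (fun n => pw (- s / 2) n ^+ 2)).
Proof.
move=> s1; have -> : (fun n => pw (- s / 2) n ^+ 2) = pw (- s).
  by apply/funext => n; rewrite pw_half_sqr.
exact: pw_summable.
Qed.

Lemma pw_unbounded x (B : R) : 0 < x -> exists N, B < pw x N.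
Proof.
move=> x0; pose C := Num.max B 1; have C0 : 0 < C by rewrite lt_max ltr01 orbT.
exists (Num.bound (C `^ x^-1)).
have h : C `^ x^-1 < (Num.bound (C `^ x^-1))%:R by apply: archi_boundP; exact: powR_ge0.
apply: le_lt_trans (_ : B <= C) _; first by rewrite le_max lexx.
rewrite [ltLHS](_ : C = (C `^ x^-1) `^ x); last by rewrite -powRrM mulVf ?gt_eqF// powRr1// ltW.
apply: gt0_ltr_powR; rewrite ?nnegrE ?powR_ge0//.
by apply: lt_trans h _; rewrite ltr_nat.
Qed.

(** The ratio of [n.+1] to [N.+1] lies between 1 and 2 on such a block, whence a
constant that depends on the exponent only. *)
Lemma pw_block x N n : (N <= n < N + N)%N -> 2 `^ (- `|x|) * pw x N <= pw x n.
Proof.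
move=> /andP[Nn n2].
have [x0|x0] := leP 0 x.
  apply: le_trans (pw_mono x0 Nn); rewrite ler_piMl ?pw_ge0//.
  by rewrite powRN invf_le1 ?powR_gt0// -[leLHS](powRr0 2) ler_powR ?ler1n// normr_ge0.
rewrite ltr0_norm// opprK /pw -powRM//.
have e (b : R) : b `^ x = (b `^ (- x))^-1 by rewrite -powRN opprK.
rewrite (e n.+1%:R) (e (2 * _)) lef_pV2 ?posrE ?powR_gt0 ?mulr_gt0//.
apply: ge0_ler_powR; rewrite ?nnegrE ?oppr_ge0 ?(ltW x0) ?mulr_ge0//.
by rewrite -natrM ler_nat mulnS mul2n -addnn (leq_trans n2)// leq_addl.
Qed.

End PowerSums.

(** * Forms depending on the maximum of the indices *)

Section MaxForms.
Variable R : realType.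
Implicit Types (x : nat -> R[i]) (h : nat -> R).

(** Summation by parts for a kernel depending on the maximum: adding the index
[N] to the section adds [h N * (|X_(N+1)|^2 - |X_N|^2)], where [X] denotes the
partial sums of [x]. *)
Lemma max_form_ge h x N : {homo h : n m / (n <= m)%N >-> m <= n} ->
  (h N * normc (\sum_(n < N.+1) x n) ^+ 2)%:C <=
  \sum_(n < N.+1) \sum_(m < N.+1) (h (maxn n m))%:C * x n * (x m)^*.
Proof.
move=> hd; elim: N => [|N ih].
  by rewrite !big_ord_recl !big_ord0 !addr0 maxnn rmorphM/= -mul_conj mulrA.
pose X := \sum_(n < N.+1) x n.
pose F n m := (h (maxn n m))%:C * x n * (x m)^*.
have e : \sum_(n < N.+2) \sum_(m < N.+2) F n m = \sum_(n < N.+1) \sum_(m < N.+1) F n m +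
    (h N.+1)%:C * ((X + x N.+1) * (X + x N.+1)^* - X * X^*).
  rewrite big_ord_recr/= [X in _ + X]big_ord_recr/=.
  under eq_bigr do rewrite big_ord_recr/=.
  rewrite big_split/= -!addrA; congr (_ + _).
  have -> : \sum_(n < N.+1) F n N.+1 = (h N.+1)%:C * X * (x N.+1)^*.
    rewrite mulr_sumr mulr_suml; apply: eq_bigr => n _.
    by rewrite /F (maxn_idPr _)// ltnW.
  have -> : \sum_(m < N.+1) F N.+1 m = (h N.+1)%:C * x N.+1 * X^*.
    rewrite rmorph_sum mulr_sumr; apply: eq_bigr => n _.
    by rewrite /F (maxn_idPl _)// ltnW.
  rewrite /F maxnn rmorphD/=; ring.
rewrite -/F e big_ord_recr/= -/X !mul_conj -rmorphB -rmorphM.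
apply: le_trans (lerD ih (lexx _)).
rewrite -/X -rmorphD lecR mulrBr addrCA lerDl -mulrBl mulr_ge0 ?sqr_ge0//.
by rewrite subr_ge0 hd.
Qed.

(** In the order of [R[i]] the hypothesis also says that each [u N] is real, and
this passes to the limit. *)
Lemma complex_cvg_le0 (u : nat -> R[i]) (z : R[i]) (r : nat -> R) :
  (u : nat -> R[i]^o) @ \oo --> (z : R[i]^o) -> r @ \oo --> (0 : R) ->
  (forall N, u N <= (r N)%:C) -> z <= 0.
Proof.
move=> /cvg_normcP uz r0 ur.
have near0 (e : R) : 0 < e -> exists N, normc (u N - z) < e /\ r N < e.
  move=> e0.
  have [N1 _ h1] := (cvgrPdist_lt _ _).1 uz _ e0.
  have [N2 _ h2] := (cvgrPdist_lt _ _).1 r0 _ e0.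
  exists (maxn N1 N2); split.
    have := h1 _ (leq_maxl N1 N2).
    by rewrite /= sub0r normrN ger0_norm// normc_ge0.
  by have := h2 _ (leq_maxr N1 N2); rewrite /= sub0r normrN; apply: le_lt_trans; exact: ler_norm.
have Im0 : Im z = 0.
  apply/eqP; rewrite -normr_eq0 eq_le normr_ge0 andbT; apply/ler_addgt0Pr => e e0.
  rewrite add0r; have [N [h _]] := near0 e e0; apply: le_trans (ltW h).
  apply: le_trans (Im_le_normc _); have := ur N; rewrite lecE/= => /andP[/eqP iu _].
  by rewrite raddfB/= -iu sub0r normrN.
have Re0 : Re z <= 0.
  apply/ler_addgt0Pr => e e0; rewrite add0r.
  have e2 : 0 < e / 2 by rewrite divr_gt0.
  have [N [h hr]] := near0 _ e2; have := ur N; rewrite lecE/= => /andP[_ ru].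
  have := le_lt_trans (le_trans (ler_norm _) (Re_le_normc (- (u N - z)))) (_ : _ < e / 2).
  rewrite normc_opp => /(_ h); rewrite opprB raddfB/= => hz.
  rewrite (splitr e) -(subrK (Re (u N)) (Re z)); apply: lerD; first exact: ltW.
  exact: le_trans ru (ltW hr).
by rewrite lecE/= Im0 eqxx.
Qed.

End MaxForms.

(** * The matrix B *)

Section MatrixB.
Variable R : realType.
Implicit Types (tau rho : R) (n m N : nat) (T : {linear ell2 R -> ell2 R}).

Definition bmat tau rho n m : R :=
  pw ((tau - rho) / 2) n * pw ((tau - rho) / 2) m * pw (- tau) (maxn n m).

Lemma BmatrixE tau rho : Bmatrix tau rho = real_matrix (bmat tau rho).
Proof.
apply/funext => n; apply/funext => m; rewrite /Bmatrix /real_matrix /bmat; congr (_%:C).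
rewrite maxnSS -powRN natrM -!powRN !powRM//.
rewrite -![_.+1%:R `^ _]/(pw _ _) mulrBl !pwD; ring.
Qed.

Lemma bmat_gt0 tau rho n m : 0 < bmat tau rho n m.
Proof. by rewrite /bmat !mulr_gt0 ?pw_gt0. Qed.

Lemma bmat_ge0 tau rho n m : 0 <= bmat tau rho n m.
Proof. exact/ltW/bmat_gt0. Qed.

Lemma bmat_sym tau rho n m : bmat tau rho n m = bmat tau rho m n.
Proof. by rewrite /bmat maxnC [pw _ n * _]mulrC. Qed.

Lemma bmat_diag tau rho n : bmat tau rho n n = pw (- rho) n.
Proof. by rewrite /bmat maxnn -!pwD; congr pw; field. Qed.

Lemma bmat_col0 tau rho n : bmat tau rho n 0 = pw (- (tau + rho) / 2) n.
Proof. by rewrite /bmat maxn0 pw_at0 mulr1 -pwD; congr pw; field. Qed.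

Lemma bmat_le_pos tau rho n m : 0 <= tau ->
  bmat tau rho n m <= pw (- rho / 2) n * pw (- rho / 2) m.
Proof.
move=> t0; have t20 : 0 <= tau / 2 by rewrite divr_ge0.
wlog nm : n m / (n <= m)%N.
  move=> h; have [nm|/ltnW mn] := leqP n m; first exact: h.
  by rewrite bmat_sym mulrC; exact: h.
rewrite /bmat (maxn_idPr nm).
have -> : (tau - rho) / 2 = tau / 2 + - rho / 2 by ring.
rewrite 2!pwD [X in _ * pw X m](_ : - tau = - (tau / 2) - tau / 2); last by field.
rewrite pwD pwN.
have -> : pw (tau / 2) n * pw (- rho / 2) n * (pw (tau / 2) m * pw (- rho / 2) m) *
    ((pw (tau / 2) m)^-1 * (pw (tau / 2) m)^-1) =
    (pw (- rho / 2) n * pw (- rho / 2) m) * (pw (tau / 2) n / pw (tau / 2) m).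
  by field; rewrite gt_eqF ?pw_gt0.
rewrite ler_piMr ?mulr_ge0 ?pw_ge0// ler_pdivrMr ?pw_gt0// mul1r.
exact: pw_mono.
Qed.

Lemma bmat_le_neg tau rho n m : tau <= 0 ->
  bmat tau rho n m <= pw (- (rho + tau) / 2) n * pw (- (rho + tau) / 2) m.
Proof.
move=> t0; wlog nm : n m / (n <= m)%N.
  move=> h; have [nm|/ltnW mn] := leqP n m; first exact: h.
  by rewrite bmat_sym mulrC; exact: h.
rewrite /bmat (maxn_idPr nm).
have -> : (tau - rho) / 2 = tau + - (rho + tau) / 2 by field.
rewrite 2!pwD pwN.
have -> : pw tau n * pw (- (rho + tau) / 2) n * (pw tau m * pw (- (rho + tau) / 2) m) /
    pw tau m = pw (- (rho + tau) / 2) n * pw (- (rho + tau) / 2) m * pw tau n.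
  by field; rewrite gt_eqF ?pw_gt0.
rewrite ler_piMr ?mulr_ge0 ?pw_ge0// -(pw0 R n).
exact: pw_le_exponent.
Qed.

Lemma bmat_operator_dominated tau rho s : 1 < s ->
  (forall n m, bmat tau rho n m <= pw (- s / 2) n * pw (- s / 2) m) ->
  exists T, [/\ bounded_operator T, matrix_of T (real_matrix (bmat tau rho)) &
    compact_operator T].
Proof.
move=> s1 bs; apply: (rank_one_dominated_operator _ _ _ _ bs).
- exact: bmat_ge0.
- exact: bmat_sym.
- by move=> n; exact: pw_gt0.
- exact: pw_half_square_summable.
Qed.

(** At the critical exponent the weights [n^(-1/2)] pass Schur's test. *)
Lemma bmat_operator_critical tau : 0 < tau ->
  exists2 T, bounded_operator T & matrix_of T (real_matrix (bmat tau 1)).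
Proof.
move=> t0; have a0 : 0 < tau / 2 by rewrite divr_gt0.
pose a := tau / 2; pose C := (1 + a) / a + a^-1.
apply: (@schur_operator _ _ (pw (- 1 / 2)) C).
- exact: bmat_ge0.
- exact: bmat_sym.
- by move=> n; exact: pw_gt0.
move=> n K.
pose F m := bmat tau 1 n m * pw (- 1 / 2) m.
have F0 m : 0 <= F m by rewrite mulr_ge0 ?bmat_ge0 ?pw_ge0.
have low m : (m <= n)%N -> F m = pw (- (tau + 1) / 2) n * pw (a - 1) m.
  move=> mn; rewrite /F /bmat (maxn_idPl mn).
  have -> : pw (- (tau + 1) / 2) n = pw ((tau - 1) / 2) n * pw (- tau) n.
    by rewrite -pwD; congr pw; field.
  have -> : pw (a - 1) m = pw ((tau - 1) / 2) m * pw (- 1 / 2) m.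
    by rewrite -pwD /a; congr pw; field.
  ring.
have high m : (n < m)%N -> F m = pw ((tau - 1) / 2) n * pw (- a - 1) m.
  move=> nm; rewrite /F /bmat (maxn_idPr (ltnW nm)).
  by rewrite -!mulrA -!pwD; congr (_ * pw _ _); rewrite /a; field.
(* The indices m <= n contribute C1 * n^(-1/2), the others C2 * n^(-1/2), where
   C1 and C2 are the two terms of C. *)
apply: (@le_trans _ _ (\sum_(0 <= m < maxn n.+1 K) F m)).
  rewrite [leRHS](big_cat_nat (n := K)) ?leq_maxr//= big_mkord lerDl.
  by apply: sumr_ge0.
rewrite (big_cat_nat (n := n.+1)) ?leq_maxl//= mulrDl; apply: lerD.
  rewrite big_mkord.
  have -> : \sum_(m < n.+1) F m = \sum_(m < n.+1) pw (- (tau + 1) / 2) n * pw (a - 1) m.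
    by apply: eq_bigr => m _; apply: low; rewrite -ltnS.
  rewrite -mulr_sumr; apply: le_trans (ler_wpM2l (pw_ge0 _ _) (sum_pw_le n a0)) _.
  rewrite mulrCA -pwD; have -> : - (tau + 1) / 2 + tau / 2 = - 1 / 2 by field.
  exact: lexx.
have -> : \sum_(n.+1 <= m < maxn n.+1 K) F m =
    \sum_(n.+1 <= m < maxn n.+1 K) pw ((tau - 1) / 2) n * pw (- a - 1) m.
  by apply: eq_big_nat => m /andP[nm _]; exact: high.
rewrite -mulr_sumr.
apply: le_trans (ler_wpM2l (pw_ge0 _ _) (sum_pw_tail_le n _ a0)) _.
rewrite mulrA -pwD mulrC; have -> : (tau - 1) / 2 - tau / 2 = - 1 / 2 by field.
exact: lexx.
Qed.

(** The first column is the image of a basis vector, hence square-summable. *)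
Lemma bmat_bounded_gt1 tau rho T : bounded_operator T ->
  matrix_of T (real_matrix (bmat tau rho)) -> 1 < tau + rho.
Proof.
move=> bT TA; apply: pw_summable_gt1.
have := @sqsum_cvg _ (T (ell2_basis R 0)).
have -> : sqsum (T (ell2_basis R 0)) = series (pw (- (tau + rho))).
  rewrite /sqsum; congr series; apply/funext => n.
  rewrite TA normc_real ger0_norm ?bmat_ge0// bmat_col0.
  exact: pw_half_sqr.
by [].
Qed.

Definition block N L (c : R) : ell2 R := \sum_(i < L) c%:C *: ell2_basis R (N + i).

Lemma block_eq0 N L c j : (N + L <= j)%N -> block N L c j = 0.
Proof.
move=> Nj; rewrite /block ell2_sumE big1// => i _.
rewrite ell2_scaleE ell2_basisE gtn_eqF ?mulr0//.
by apply: leq_trans Nj; rewrite ltn_add2l.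
Qed.

Lemma block_norm N L c : ell2_norm (block N L c) ^+ 2 = L%:R * c ^+ 2.
Proof.
elim: L => [|L ih].
  by rewrite /block big_ord0 ell2_norm0 expr0n mul0r.
apply: complexI; rewrite -dotp_self.
rewrite [block N L.+1 c](_ : _ = (block N L c + c%:C *: ell2_basis R (N + L))%R); last first.
  by rewrite /block big_ord_recr.
have z : dotp (block N L c) (ell2_basis R (N + L)) = 0.
  by rewrite dotp_basisr block_eq0.
rewrite !(dotpDl, dotpDr, dotpZl, dotpZr) z -(dotp_conj (block N L c) (ell2_basis R _)) z conjC0.
rewrite !mulr0 addr0 add0r !dotp_self ih ell2_norm_basis expr1n mulr1 conj_real.
by rewrite -rmorphM -rmorphD -expr2 -[L.+1%:R]natr1 mulrDl mul1r.
Qed.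

Lemma block_image T A N L c n : matrix_of T (real_matrix A) ->
  T (block N L c) n = (c * \sum_(i < L) A n (N + i)%N)%:C.
Proof.
move=> TA; rewrite /block linear_sum ell2_sumE mulr_sumr rmorph_sum.
by apply: eq_bigr => i _; rewrite [T _]linearZ ell2_scaleE TA -rmorphM.
Qed.

Lemma sum_block_le (f : ell2 R) N :
  \sum_(i < N) normc (f (N + i)%N) ^+ 2 <= ell2_norm f ^+ 2 - sqsum f N.
Proof.
rewrite sqsumE lerBrDl; apply: le_trans (sum_le_ell2_norm f (N + N)).
by rewrite big_split_ord.
Qed.

(** The constants of [pw_block] for the three powers in an entry, multiplied. *)
Definition block_const tau rho : R :=
  2 `^ (- `|(tau - rho) / 2|) * 2 `^ (- `|(tau - rho) / 2|) * 2 `^ (- `|- tau|).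

Lemma block_const_gt0 tau rho : 0 < block_const tau rho.
Proof. by rewrite /block_const !mulr_gt0 ?powR_gt0. Qed.

Lemma bmat_block tau rho N n m : (N <= n < N + N)%N -> (N <= m < N + N)%N ->
  block_const tau rho * pw (- rho) N <= bmat tau rho n m.
Proof.
move=> nN mN; rewrite -(bmat_diag tau rho) /bmat maxnn.
have MN : (N <= maxn n m < N + N)%N by rewrite /maxn; case: ifP.
have P0 (x : R) : 0 <= 2 `^ (- `|x|) * pw x N by rewrite mulr_ge0 ?powR_ge0 ?pw_ge0.
have -> : block_const tau rho * (pw ((tau - rho) / 2) N * pw ((tau - rho) / 2) N * pw (- tau) N) =
   (2 `^ (- `|(tau - rho) / 2|) * pw ((tau - rho) / 2) N) *
   (2 `^ (- `|(tau - rho) / 2|) * pw ((tau - rho) / 2) N) *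
   (2 `^ (- `|- tau|) * pw (- tau) N).
  by rewrite /block_const; ring.
apply: ler_pM; [by apply: mulr_ge0; exact: P0|exact: P0| |exact: pw_block].
by apply: ler_pM; [exact: P0|exact: P0|exact: pw_block|exact: pw_block].
Qed.

Definition block_vector N : ell2 R := block N.+1 N.+1 (Num.sqrt N.+1%:R)^-1.

Lemma block_vector_norm N : ell2_norm (block_vector N) = 1.
Proof.
apply/eqP; rewrite -(@sqrp_eq1 _ (ell2_norm _)) ?ell2_norm_ge0// block_norm.
by rewrite exprVn sqr_sqrtr// mulfV.
Qed.

(** The normalized indicator of a dyadic block is mapped to a vector whose mass
on the same block is of order [N^(1 - rho)]. *)
Lemma block_vector_image tau rho T N : matrix_of T (real_matrix (bmat tau rho)) ->
  (block_const tau rho / 2 * pw (1 - rho) N.+1) ^+ 2 <=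
  \sum_(i < N.+1) normc (T (block_vector N) (N.+1 + i)%N) ^+ 2.
Proof.
move=> TA; set kappa := block_const tau rho.
have k0 : 0 < kappa by exact: block_const_gt0.
set S := Num.sqrt (N.+1%:R : R); have S0 : 0 < S by rewrite sqrtr_gt0.
have S2 : S ^+ 2 = N.+1%:R by rewrite sqr_sqrtr.
apply: (@le_trans _ _ (\sum_(i < N.+1) (S * (kappa * pw (- rho) N.+1)) ^+ 2)).
  rewrite sumr_const card_ord -[leRHS]mulr_natl -S2 -exprMn.
  rewrite ler_sqr ?nnegrE ?mulr_ge0 ?pw_ge0 ?(ltW S0) ?(ltW k0) ?invr_ge0//.
  rewrite pwD pw1.
  have -> : S * (S * (kappa * pw (- rho) N.+1)) = kappa * pw (- rho) N.+1 * S ^+ 2 by ring.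
  have -> : kappa / 2 * (N.+2%:R * pw (- rho) N.+1) = kappa * pw (- rho) N.+1 * (N.+2%:R / 2).
    by field.
  rewrite ler_wpM2l ?mulr_ge0 ?pw_ge0 ?(ltW k0)// S2 ler_pdivrMr// -natrM ler_nat.
  by rewrite muln2 -addnn addSn ltnS leq_addl.
apply: ler_sum => i _; rewrite ler_sqr ?nnegrE ?normc_ge0//; last first.
  by rewrite !mulr_ge0 ?pw_ge0 ?(ltW S0) ?(ltW k0).
rewrite (block_image _ _ _ _ TA) normc_real; apply: le_trans (ler_norm _).
rewrite -/S -ler_pdivrMl ?invr_gt0// invrK.
have -> : S * (S * (kappa * pw (- rho) N.+1)) = \sum_(j < N.+1) (kappa * pw (- rho) N.+1).
  by rewrite sumr_const card_ord -[RHS]mulr_natl -S2; ring.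
by apply: ler_sum => j _; apply: bmat_block; rewrite leq_addr ltn_add2l ltn_ord.
Qed.

Lemma bmat_unbounded tau rho T : rho < 1 -> bounded_operator T ->
  matrix_of T (real_matrix (bmat tau rho)) -> False.
Proof.
move=> r1 bT TA; have [M M0 TM] := bounded_operatorP bT.
set c := block_const tau rho / 2; have c0 : 0 < c by rewrite divr_gt0 ?block_const_gt0.
have bound N : pw (1 - rho) N.+1 <= M / c.
  rewrite ler_pdivlMr// mulrC -ler_sqr ?nnegrE ?mulr_ge0 ?pw_ge0 ?(ltW c0)//.
  apply: le_trans (block_vector_image N TA) _.
  apply: le_trans (sum_block_le _ _) _.
  apply: (@le_trans _ _ (ell2_norm (T (block_vector N)) ^+ 2)).
    by rewrite lerBlDr lerDl sqsum_ge0.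
  rewrite ler_sqr ?nnegrE ?ell2_norm_ge0//.
  by apply: le_trans (TM _) _; rewrite block_vector_norm mulr1.
have r0 : 0 < 1 - rho by rewrite subr_gt0.
have [N hN] := pw_unbounded (M / c) r0.
have := lt_le_trans hN (pw_mono (ltW r0) (leqnSn N)).
by move/lt_le_trans/(_ (bound N)); rewrite ltxx.
Qed.

(** The images of the block vectors keep a fixed mass on blocks that escape to
infinity, so they have no cluster point. *)
Lemma bmat_not_compact tau rho T : rho <= 1 -> compact_operator T ->
  matrix_of T (real_matrix (bmat tau rho)) -> False.
Proof.
move=> r1 cT TA.
have u1 k : ell2_norm (block_vector k) <= 1 by rewrite block_vector_norm.
have [h hP] := compact_operator_cluster cT u1.
set c := block_const tau rho / 2; have c0 : 0 < c by rewrite divr_gt0 ?block_const_gt0.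
have c4 : 0 < c / 4 by rewrite divr_gt0.
have e0 : 0 < (c / 4) ^+ 2 by rewrite exprn_gt0.
have /cvgrPdist_lt/(_ _ e0)[K _ hK] : sqsum h @ \oo --> limn (sqsum h) by exact: sqsum_cvg.
have [k Kk hk] := hP _ K c4.
have tail : ell2_norm h ^+ 2 - sqsum h k.+1 < (c / 4) ^+ 2.
  rewrite ell2_norm_sqr; apply: le_lt_trans (ler_norm _) (hK k.+1 _).
  exact: leqW.
pose g := (T (block_vector k) - h)%R.
have cB : c ^+ 2 <= \sum_(i < k.+1) normc (T (block_vector k) (k.+1 + i)%N) ^+ 2.
  apply: le_trans (block_vector_image k TA); rewrite -/c [leRHS]exprMn ler_peMr ?sqr_ge0//.
  rewrite exprn_ege1// -[leLHS](pw_at0 (1 - rho)).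
  by apply: pw_mono; rewrite ?subr_ge0.
have pt i : normc (T (block_vector k) (k.+1 + i)%N) ^+ 2 <=
    2 * normc (g (k.+1 + i)%N) ^+ 2 + 2 * normc (h (k.+1 + i)%N) ^+ 2.
  have -> : T (block_vector k) (k.+1 + i)%N = g (k.+1 + i)%N + h (k.+1 + i)%N.
    by rewrite /g ell2_addE ell2_oppE subrK.
  set x := g _; set y := h _.
  apply: (@le_trans _ _ ((normc x + normc y) ^+ 2)).
    by rewrite ler_sqr ?nnegrE ?addr_ge0 ?normc_ge0// normcD.
  rewrite -subr_ge0; have -> : 2 * normc x ^+ 2 + 2 * normc y ^+ 2 - (normc x + normc y) ^+ 2 =
    (normc x - normc y) ^+ 2 by ring.
  exact: sqr_ge0.
have g2 : ell2_norm g ^+ 2 < (c / 4) ^+ 2.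
  by rewrite ltr_sqr ?nnegrE ?ell2_norm_ge0 ?(ltW c4).
have gs : \sum_(i < k.+1) normc (g (k.+1 + i)%N) ^+ 2 <= ell2_norm g ^+ 2.
  by apply: le_trans (sum_block_le g k.+1) _; rewrite lerBlDr lerDl sqsum_ge0.
have hs := sum_block_le h k.+1.
have : c ^+ 2 <= 2 * \sum_(i < k.+1) normc (g (k.+1 + i)%N) ^+ 2 +
    2 * \sum_(i < k.+1) normc (h (k.+1 + i)%N) ^+ 2.
  apply: le_trans cB _; rewrite !mulr_sumr -big_split/=; apply: ler_sum => i _.
  exact: pt.
(* The mass c^2 would be at most 2 (c/4)^2 + 2 (c/4)^2. *)
move: (exprn_gt0 2 c0) => c20.
have E : (c / 4) ^+ 2 = c ^+ 2 / 16 by field.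
rewrite E in tail g2; lra.
Qed.

End MatrixB.

(** * Signs and trace class *)

Section Signs.
Variable R : realType.
Implicit Types (tau rho : R) (n m N : nat) (T : {linear ell2 R -> ell2 R}).

Lemma bmat_form tau rho (f : nat -> R[i]) N :
  \sum_(n < N) \sum_(m < N) real_matrix (bmat tau rho) n m * f n * (f m)^* =
  \sum_(n < N) \sum_(m < N) (pw (- tau) (maxn n m))%:C *
    ((pw ((tau - rho) / 2) n)%:C * f n) * ((pw ((tau - rho) / 2) m)%:C * f m)^*.
Proof.
apply: eq_bigr => n _; apply: eq_bigr => m _.
by rewrite /real_matrix /bmat !rmorphM/= conj_real; ring.
Qed.

Lemma bmat_psd tau rho : 0 < tau -> psd_matrix (real_matrix (bmat tau rho)).
Proof.
move=> t0 f [|N] _; first by rewrite big_ord0.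
have hd : {homo pw (- tau) : n m / (n <= m)%N >-> m <= n}.
  by move=> n m; apply: pw_anti; exact: ltW.
rewrite bmat_form.
apply: le_trans (max_form_ge (fun n => (pw ((tau - rho) / 2) n)%:C * f n) N hd).
by rewrite lecR mulr_ge0 ?pw_ge0// sqr_ge0.
Qed.

Lemma bmat_symmetric_operator tau rho T : bounded_operator T ->
  matrix_of T (real_matrix (bmat tau rho)) -> adjoint_of T T.
Proof.
move=> bT TA; apply: (symmetric_operator bT TA) => n m.
by rewrite conj_real /real_matrix bmat_sym.
Qed.

Lemma bmat_form_cvg tau rho T (f : ell2 R) : bounded_operator T ->
  matrix_of T (real_matrix (bmat tau rho)) ->
  (fun N => \sum_(n < N) \sum_(m < N) real_matrix (bmat tau rho) n m * f n * (f m)^*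
     : R[i]^o) @ \oo --> (dotp (T f) f : R[i]^o).
Proof.
move=> bT TA; apply: cvg_eq (@form_cvg _ T _ f f bT TA) => N.
rewrite exchange_big; apply: eq_bigr => n _; apply: eq_bigr => m _.
by rewrite /real_matrix bmat_sym.
Qed.

Lemma bmat_positive_operator tau rho T : 0 < tau -> bounded_operator T ->
  matrix_of T (real_matrix (bmat tau rho)) -> positive_operator T.
Proof.
move=> t0 bT TA f; rewrite -oppr_le0.
pose S N := \sum_(n < N) \sum_(m < N) real_matrix (bmat tau rho) n m * f n * (f m)^*.
apply: (@complex_cvg_le0 _ (fun N => - S N) _ (fun=> 0)) => [||N].
- by apply: cvgN; exact: bmat_form_cvg.
- exact: cvg_cst.
rewrite oppr_le0 /S (eq_bigr (fun n : 'I_N => \sum_(m < N)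
  real_matrix (bmat tau rho) n m * truncation N f n * (truncation N f m)^*)); last first.
  by move=> n _; apply: eq_bigr => m _; rewrite !truncationE !ltn_ord.
by apply: (bmat_psd _ t0) => n; rewrite truncationE ltnNge => ->.
Qed.

Section NegativeExponent.
Variables (tau rho : R).
Hypotheses (t0 : tau < 0) (tr : 1 < rho + tau).

Let rho1 : 1 < rho. Proof. by move: t0 tr => ? ?; lra. Qed.

Let diff1 : 1 < rho - tau. Proof. by move: t0 tr => ? ?; lra. Qed.

Let weight_ell2 : (fun n => (pw ((tau - rho) / 2) n)%:C) \in @ell2_pred R.
Proof.
apply/ell2P; rewrite /sqsum.
have -> : (fun n => normc (pw ((tau - rho) / 2) n)%:C ^+ 2) = pw (- (rho - tau)).
  apply/funext => n; rewrite normc_real ger0_norm ?pw_ge0// opprB.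
  exact: pw_half_sqr.
exact: pw_summable.
Qed.

(** Normal vector of the hyperplane on which the form is nonpositive. *)
Definition weight : ell2 R := Ell2 weight_ell2.

Lemma abs_weighted_summable (f : ell2 R) :
  cvgn (series (fun n => pw (- rho / 2) n * normc (f n))).
Proof.
pose B := Num.sqrt (limn (series (pw (- rho)))) * ell2_norm f.
have cs := pw_summable rho1.
have P0 n : 0 <= pw (- rho) n by exact: pw_ge0.
apply: (@nneg_series_cvg _ _ B) => [n|N]; first by rewrite mulr_ge0 ?pw_ge0 ?normc_ge0.
apply: le_trans (ler_norm _) _; rewrite -sqrtr_sqr.
have -> : B = Num.sqrt (limn (series (pw (- rho))) * ell2_norm f ^+ 2).
  rewrite sqrtrM ?sqrtr_sqr ?ger0_norm ?ell2_norm_ge0//.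
  by apply: le_trans (nneg_series_le_lim 0 P0 cs); rewrite big_ord0.
apply: ler_wsqrtr.
apply: le_trans (cauchy_schwarz_sum (pw (- rho / 2)) (fun n => normc (f n)) N) _.
apply: ler_pM; last exact: sum_le_ell2_norm.
- by apply: sumr_ge0 => k _; exact: sqr_ge0.
- by apply: sumr_ge0 => k _; exact: sqr_ge0.
by under eq_bigr do rewrite pw_half_sqr; exact: nneg_series_le_lim.
Qed.

(** The kernel [max(n,m)^|tau|] is conditionally negative: on the orthogonal
complement of the weight, the partial sums [X_N] in the summation by parts are
tails, so that [N^|tau| |X_N|^2] tends to zero. *)
Lemma bmat_negative_form T (g : ell2 R) : bounded_operator T ->
  matrix_of T (real_matrix (bmat tau rho)) -> dotp g weight = 0 ->
  dotp (T g) g <= 0.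
Proof.
move=> bT TA gw.
pose x n := (pw ((tau - rho) / 2) n)%:C * g n.
pose X N := \sum_(n < N) x n.
pose y n := pw (- rho / 2) n * normc (g n).
have y0 n : 0 <= y n by rewrite mulr_ge0 ?pw_ge0 ?normc_ge0.
have cy : cvgn (series y) by exact: abs_weighted_summable.
have X0 : (X : nat -> R[i]^o) @ \oo --> (0 : R[i]^o).
  rewrite -gw; apply: cvg_eq (@dotp_cvg _ g weight) => N.
  rewrite /series/= big_mkord; apply: eq_bigr => n _.
  by rewrite conj_real mulrC.
have xy N n : (N <= n)%N -> pw (- tau / 2) N * normc (x n) <= y n.
  move=> Nn; rewrite /x /y ComplexField.Normc.normcM normc_real ger0_norm ?pw_ge0//.
  rewrite mulrA ler_wpM2r ?normc_ge0//.
  have -> : - rho / 2 = - tau / 2 + (tau - rho) / 2 by field.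
  rewrite pwD ler_wpM2r ?pw_ge0//; apply: pw_mono => //.
  by rewrite divr_ge0// oppr_ge0 ltW.
have tail N : pw (- tau / 2) N * normc (X N.+1) <= limn (series y) - series y N.+1.
  rewrite mulrC -ler_pdivlMr ?pw_gt0//.
  have cX : (fun K => X N.+1 - X (K + N.+1)%N : R[i]^o) @ \oo --> (X N.+1 : R[i]^o).
    rewrite -[X in _ --> X](subr0 (X N.+1 : R[i]^o)); apply: cvgB; first exact: cvg_cst.
    by rewrite (cvg_shiftn N.+1 (X : nat -> R[i]^o)).
  apply: normc_lim_le cX _ => K.
  rewrite ler_pdivlMr ?pw_gt0// mulrC -normc_opp opprB.
  have -> : X (K + N.+1)%N - X N.+1 = \sum_(N.+1 <= n < K + N.+1) x n.
    rewrite /X -!(big_mkord xpredT x) (big_cat_nat (n := N.+1)) ?leq_addl//=.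
    by rewrite addrAC subrr add0r.
  apply: le_trans (ler_wpM2l (pw_ge0 _ _) (normc_sum _ _ _)) _.
  apply: le_trans (nneg_series_tail_le N.+1 (K + N.+1) y0 cy).
  rewrite mulr_sumr big_nat [leRHS]big_nat; apply: ler_sum => n /andP[Nn _].
  by apply: xy; exact: ltnW.
pose r N := (limn (series y) - series y N) ^+ 2.
have r0 : r @ \oo --> (0 : R).
  have h : (fun N => limn (series y) - series y N) @ \oo --> (0 : R).
    rewrite -[X in _ --> X](subrr (limn (series y))).
    by apply: cvgB; [exact: cvg_cst|exact: cy].
  by rewrite -[X in _ --> X](mulr0 (0 : R)); apply: cvgM.
pose S N := \sum_(n < N) \sum_(m < N) real_matrix (bmat tau rho) n m * g n * (g m)^*.
apply: (@complex_cvg_le0 _ S _ r _ r0); first exact: bmat_form_cvg.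
rewrite /S => -[|N].
  by rewrite big_ord0 lecR sqr_ge0.
rewrite bmat_form -/(x _).
have hd : {homo (fun n => - pw (- tau) n) : n m / (n <= m)%N >-> m <= n}.
  by move=> n m nm; rewrite lerN2; apply: pw_mono => //; rewrite oppr_ge0 ltW.
rewrite -lerN2; apply: (@le_trans _ _ (\sum_(n < N.+1)
    \sum_(m < N.+1) (- pw (- tau) (maxn n m))%:C * x n * (x m)^*)); last first.
  rewrite -sumrN le_eqVlt; apply/orP; left; apply/eqP; apply: eq_bigr => n _.
  by rewrite -sumrN; apply: eq_bigr => m _; rewrite rmorphN /x; ring.
apply: le_trans (max_form_ge x N hd).
rewrite -rmorphN lecR mulNr lerN2 /r.
rewrite -pw_half_sqr -exprMn ler_sqr ?nnegrE ?mulr_ge0 ?pw_ge0 ?normc_ge0//.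
exact: le_trans (mulr_ge0 (pw_ge0 _ _) (normc_ge0 _)) (tail N).
Qed.

End NegativeExponent.

Lemma bmat_basis_form tau rho T n : matrix_of T (real_matrix (bmat tau rho)) ->
  dotp (T (ell2_basis R n)) (ell2_basis R n) = (pw (- rho) n)%:C.
Proof. by move=> TA; rewrite dotp_basisr TA /real_matrix bmat_diag. Qed.

Lemma bmat_trace_class_pos tau rho T : 0 < tau -> 1 < rho -> bounded_operator T ->
  matrix_of T (real_matrix (bmat tau rho)) -> trace_class_operator T.
Proof.
move=> t0 r1 bT TA; apply: (@trace_class_positive _ T (pw (- rho)) bT).
- exact: bmat_symmetric_operator bT TA.
- exact: bmat_positive_operator t0 bT TA.
- by move=> n; exact: bmat_basis_form TA.
- by move=> n; exact: pw_ge0.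
- exact: pw_summable.
Qed.

Lemma bmat_trace_class_neg tau rho T : tau < 0 -> 1 < rho + tau ->
  bounded_operator T -> compact_operator T ->
  matrix_of T (real_matrix (bmat tau rho)) -> trace_class_operator T.
Proof.
move=> t0 tr bT cT TA.
apply: (@trace_class_one_positive _ T (weight t0 tr) (pw (- rho)) bT _ cT).
- exact: bmat_symmetric_operator bT TA.
- by exists (ell2_basis R 0); rewrite (bmat_basis_form _ TA) pw_at0.
- by move=> g; exact: bmat_negative_form.
- by move=> n; exact: bmat_basis_form TA.
- by move=> n; exact: pw_ge0.
- by apply: pw_summable; lra.
Qed.

End Signs.

Theorem mainTheorem5 (R : realType) (tau rho : R) :
  (0 < tau ->
     psd_matrix (Bmatrix tau rho) /\
     (1 < rho -> [/\ bounded_matrix (Bmatrix tau rho),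
                     compact_matrix (Bmatrix tau rho)
                   & trace_class_matrix (Bmatrix tau rho)]) /\
     (rho = 1 -> bounded_matrix (Bmatrix tau rho) /\
                 ~ compact_matrix (Bmatrix tau rho)) /\
     (rho < 1 -> ~ bounded_matrix (Bmatrix tau rho))) /\
  (tau = 0 ->
     formally_rank_one (Bmatrix tau rho) /\
     (bounded_matrix (Bmatrix tau rho) <-> 1 < rho)) /\
  (tau < 0 ->
     (bounded_matrix (Bmatrix tau rho) <-> 1 < rho + tau) /\
     (1 < rho + tau -> compact_matrix (Bmatrix tau rho) /\
                       trace_class_matrix (Bmatrix tau rho))).
Proof.
rewrite BmatrixE; split; [|split].
- move=> t0; split; first exact: bmat_psd.
  split.
    move=> r1; have [T [bT TA cT]] := bmat_operator_dominated r1
      (fun n m => @bmat_le_pos _ tau rho n m (ltW t0)).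
    split; [by exists T|by exists T|exists T; split => //].
    exact: bmat_trace_class_pos bT TA.
  split=> [r1|r1 [T bT TA]]; last exact: bmat_unbounded r1 bT TA.
  split; first by rewrite r1; exact: bmat_operator_critical.
  by move=> [T [_ TA cT]]; apply: bmat_not_compact cT TA; rewrite r1.
- move=> t0; split.
    exists (fun n => (pw (- rho / 2) n)%:C%C).
      move=> /(congr1 (fun u => u 0%N)) /complexI/eqP.
      by rewrite pw_at0 oner_eq0.
    move=> n m; rewrite -rmorphM /real_matrix /bmat t0 oppr0 pw0 mulr1 sub0r.
    by [].
  split=> [[T bT TA]|r1].
    by have := bmat_bounded_gt1 bT TA; rewrite t0 add0r.
  have t0' : 0 <= tau by rewrite t0.
  have [T [bT TA _]] := bmat_operator_dominated r1
    (fun n m => @bmat_le_pos _ tau rho n m t0').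
  by exists T.
- move=> t0; have dom (tr : 1 < rho + tau) := bmat_operator_dominated tr
    (fun n m => @bmat_le_neg _ tau rho n m (ltW t0)).
  split.
    split=> [[T bT TA]|/dom[T [bT TA _]]]; last by exists T.
    by rewrite addrC; exact: bmat_bounded_gt1 bT TA.
  move=> tr; have [T [bT TA cT]] := dom tr.
  split; exists T; split => //.
  exact: bmat_trace_class_neg t0 tr bT cT TA.
Qed.
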